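(* Let $g:[0,1]\times E\to\mathbb R$ be bounded and measurable and assume: (i) there is $L>0$ such that $\sup_{x\in E}\|\delta_xQ_u-\delta_xQ_v\|_{\mathrm{TV}}\le L|u-v|$ for all $u,v\in[0,1]$; (ii) there are an integer $m\ge 1$ and $r\in(0,1)$ such that $\sup_{u\in[0,1]}\sup_{x,y\in E}\|\delta_xQ_u^m-\delta_yQ_u^m\|_{\mathrm{TV}}\le r$; (iii) there is $K<\infty$ such that $\sup_{u\in[0,1]}\|g(u,\cdot)\|_\infty\le K$; (iv) there is $C_g\ge 0$ such that $|g(u,x)-g(v,x)|\le C_g|u-v|$ for all $u,v\in[0,1]$, $x\in E$. Suppose also that $a>0$. Then for every sequence $(c_n)$ such that $\lim_{n\to\infty}\frac{c_n}{\sqrt n}=\infty$ and $\lim_{n\to\infty}\frac{c_n}{n}=0$: for all open sets $\Gamma\subset\mathbb R$, $$-\inf_{x\in\Gamma}\frac{x^2}{2a^2}\le\liminf_{n\to\infty}\frac1{c_n^2/n}\ln\mathbb P\big((S_n-bn)/c_n\in\Gamma\big),$$ and for all closed sets $\Gamma\subset\mathbb R$, $$\limsup_{n\to\infty}\frac1{c_n^2/n}\ln\mathbb P\big((S_n-bn)/c_n\in\Gamma\big)\le-\inf_{x\in\Gamma}\frac{x^2}{2a^2}.$$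
   Context: $(E,d)$ is a metric space with Borel $\sigma$-algebra $\mathcal B(E)$ and $\{Q_u:u\in[0,1]\}$ is a family of Markov transition kernels on $(E,\mathcal B(E))$. For probability measures, $\|\mu-\nu\|_{\mathrm{TV}}=\sup_{\|f\|_\infty\le1}|\int f\,d\mu-\int f\,d\nu|=2\sup_{A\in\mathcal B(E)}|\mu(A)-\nu(A)|$; $\delta_x$ is the Dirac mass at $x$. Conventions: $\ln0=-\infty$, $\inf\emptyset=+\infty$. Under (i)-(ii) each $Q_u$ has a unique invariant probability measure, denoted $\pi_u$. For each $n\ge1$, $X_{n,0},X_{n,1},\dots,X_{n,n}$ is an inhomogeneous Markov chain on $E$ with $X_{n,0}\sim\pi_0$ (the measure $\pi_u$ at $u=0$) and $\mathbb P(X_{n,k}\in A\mid X_{n,k-1}=x)=Q_{k/n}(x,A)$ for $1\le k\le n$. Set $S_n=\sum_{k=1}^n g(k/n,X_{n,k})$. Constants: $b=\int_0^1\int_E g(u,x)\,d\pi_u(x)\,du$; $a\ge0$ is given by $a^2=\int_0^1a_u^2\,du$, where $a_u^2=\lim_{n\to\infty}\frac1n\operatorname{Var}(\sum_{j=1}^ng(u,Y_{j,u}))$ and $(Y_{j,u})_{j\ge0}$ is the stationary Markov chain with transition operator $Q_u$ (initial law $\pi_u$). *)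

(* Defs.v *)
From HB Require Import structures.
From mathcomp Require Import all_boot all_order all_algebra.
From mathcomp Require Import all_classical all_reals all_analysis.
From mathcomp Require Import measurable_realfun.

Set Implicit Arguments.
Unset Strict Implicit.
Unset Printing Implicit Defensive.

Import Order.TTheory GRing.Theory Num.Theory.
Import numFieldNormedType.Exports.

Local Open Scope classical_set_scope.
Local Open Scope ring_scope.

(* A measurableType has to be pointed. The point only records that the space
   is nonempty, as any space carrying a probability measure is. *)
#[short(type="pointedMetricType")]
HB.structure Definition PointedMetric (K : numDomainType) :=
  {M of Metric K M & isPointed M}.

Notation borel E := (g_sigma_algebraType (@open E)).

Section transition_kernels.
Context d (T : measurableType d) (R : realType).

(* No factor 1/2: values range over [0, 2] for probability measures. *)
Definition tv_dist (mu nu : {measure set T -> \bar R}) : \bar R :=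
  ereal_sup [set `| \int[mu]_x (f x)%:E - \int[nu]_x (f x)%:E |%E
            | f in [set f : T -> R | measurable_fun setT f /\
                                     forall x, `|f x| <= 1]].

(* The measure kiter k n x is delta_x k^n. *)
Fixpoint kiter (k : R.-pker T ~> T) (n : nat) : R.-spker T ~> T :=
  if n is n'.+1 then mkcomp_noparam k (kiter k n')
  else kdirac (@measurable_id _ T setT).

Definition invariant_measure (k : R.-pker T ~> T) (mu : probability T R) :=
  forall A, measurable A -> (\int[mu]_x k x A)%E = mu A.

End transition_kernels.

Section markov_chains.
Context d (Omega : measurableType d) d' (T : measurableType d') (R : realType).
Variable P : probability Omega R.

(* f is a version of the conditional probability P(B | G). *)
Definition is_cond_prob (G : set (set Omega)) (B : set Omega)
    (f : Omega -> \bar R) :=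
  (forall U : set (\bar R), measurable U -> G (f @^-1` U)) /\
  (forall H, G H -> \int[P]_(w in H) f w = P (H `&` B))%E.

(* The sigma-algebra generated by X 0, ..., X k.-1. *)
Definition sigma_past (X : nat -> {RV P >-> T}) (k : nat) : set (set Omega) :=
  <<s \bigcup_(i in `I_k) preimage_set_system setT (X i) measurable >>.

(* X 0, ..., X n is a Markov chain with initial law mu whose k-th step uses the
   kernel Q k; the variables X i with i > n are unconstrained. *)
Definition markov_chain (Q : nat -> R.-pker T ~> T) (mu : probability T R)
    (n : nat) (X : nat -> {RV P >-> T}) :=
  (forall A, measurable A -> P (X 0%N @^-1` A) = mu A) /\
  (forall k, (1 <= k <= n)%N -> forall A, measurable A ->
    is_cond_prob (sigma_past X k) (X k @^-1` A) (fun w => Q k (X k.-1 w) A)).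

Definition stationary_chain (Q : R.-pker T ~> T) (mu : probability T R)
    (X : nat -> {RV P >-> T}) :=
  invariant_measure Q mu /\ forall n, markov_chain (fun=> Q) mu n X.

Definition asymptotic_variance (X : nat -> {RV P >-> T}) (f : T -> R) : R :=
  limn (fun n : nat =>
    fine 'V_P[fun w => \sum_(1 <= j < n.+1) f (X j w)] / n%:R).

End markov_chains.

Definition gaussian_rate (R : realType) (a : R) (A : set R) : \bar R :=
  ereal_inf [set (x ^+ 2 / (2 * a ^+ 2))%:E | x in A].

(* Main.v *)
Require Import Defs.
From HB Require Import structures.
From mathcomp Require Import all_boot all_order all_algebra.
From mathcomp Require Import all_classical all_reals all_analysis.
From mathcomp Require Import measurable_realfun.
From mathcomp Require Import ring lra.

(** Poisson's equation gives the logarithmic moment generating function of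
    [S_n - b n]. With [f_u] the centred observable,
    [phi_u] the sum of the [Q_u^j f_u] over j >= 1,
    [F_u = f_u^2/2 + f_u phi_u] and [psi_u] the same sum for the centred [F_u],
    the function [U = 1 + l phi_u + l^2 psi_u] satisfies
    [Q_u (e^(l f_u) U) = (1 + l^2 pi_u(F_u)) U + O(l^3)], and [U] is
    [O(l)]-Lipschitz in [u]. Iterating along the chain gives
    [ln E e^(l (S_n - b n)) = l^2 n a^2/2 + O(n l^3 + l + l^2 + 1)], because
    [2 pi_u(F_u)] is the asymptotic variance at [u]. Taking [l = t c_n / n]
    yields the Gaussian limit of the scaled logarithmic moment generating
    function, from which both bounds follow as in the Gartner-Ellis theorem:
    Chernoff's inequality above, exponential tilting below. *)

Import Order.TTheory GRing.Theory Num.Theory.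
Import numFieldNormedType.Exports.

Set Implicit Arguments.
Unset Strict Implicit.
Unset Printing Implicit Defensive.

Local Open Scope classical_set_scope.
Local Open Scope ring_scope.

(** * Bounded measurable functions *)

(** The shape of [U] is forced order by order: the coefficient of l in Q_u (e^(l f_u) U) - U is Q_u
    (f_u + phi_u) - phi_u, which the Poisson equation annihilates, and that of l^2 is Q_u (F_u +
    psi_u) - psi_u, which it reduces to the constant pi_u(F_u). The obstacle is inhomogeneity: each
    step has to replace the eigenfunction at k/n by the one at (k-1)/n. Lipschitz continuity of the
    Poisson solutions in u makes this cost O(l/n) per step. Errors must be multiplicative to be
    iterated, hence the need for two-sided bounds on [U]. At l = t c_n / n the main term is of order
    c_n^2 / n; relative to it the errors n l^3 and l are of order c_n / n and 1 / c_n, and a bounded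
    one is of order n / c_n^2. The growth conditions on c_n make all three vanish. Kernels,
    invariance and conditional probabilities are given on sets, while the argument lives on bounded
    functions; uniform approximation carries one to the other. *)

Definition bm d (T : measurableType d) (R : realType) (f : T -> R) :=
  measurable_fun setT f /\ exists M : R, forall x, `|f x| <= M.

Section bounded_measurable.
Context d (T : measurableType d) (R : realType).
Implicit Types f h : T -> R.

Lemma bm_cst (c : R) : bm (fun _ : T => c).
Proof. by split; [exact: measurable_cst|exists `|c|]. Qed.

Lemma bmD {f h} : bm f -> bm h -> bm (fun x => f x + h x).
Proof.
move=> [mf [M fM]] [mh [N hN]]; split; first exact: measurable_funD.
by exists (M + N) => x; rewrite (le_trans (ler_normD _ _))// lerD.
Qed.

Lemma bmM {f h} : bm f -> bm h -> bm (fun x => f x * h x).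
Proof.
move=> [mf [M fM]] [mh [N hN]]; split; first exact: measurable_funM.
by exists (M * N) => x; rewrite normrM ler_pM.
Qed.

Lemma bmZ (c : R) {f} : bm f -> bm (fun x => c * f x).
Proof. by move=> bf; apply: (bmM (bm_cst c)). Qed.

Lemma bmB {f h} : bm f -> bm h -> bm (fun x => f x - h x).
Proof.
move=> bf bh; have := bmD bf (bmZ (-1) bh).
by congr bm; apply/funext => x; rewrite mulN1r.
Qed.

Lemma bm_sum (I : eqType) (s : seq I) (F : I -> T -> R) :
  {in s, forall i, bm (F i)} -> bm (fun x => \sum_(i <- s) F i x).
Proof.
elim: s => [|i s IH] bF.
  by under [X in bm X]funext do rewrite big_nil; exact: bm_cst.
under [X in bm X]funext do rewrite big_cons; apply: bmD.
  by apply: bF; rewrite mem_head.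
by apply: IH => j js; apply: bF; rewrite in_cons js orbT.
Qed.

Lemma bm_indic (A : set T) : measurable A -> bm (\1_A : T -> R).
Proof.
move=> mA; split; first exact: measurable_indic.
by exists 1 => x; rewrite indicE; case: (_ \in _); rewrite ?normr0 ?normr1.
Qed.

Lemma bm_expR {f} : bm f -> bm (fun x => expR (f x)).
Proof.
move=> [mf [M fM]]; split.
  exact: (measurableT_comp (@measurable_expR R)).
exists (expR M) => x; rewrite ger0_norm ?expR_ge0// ler_expR.
exact: le_trans (ler_norm _) (fM x).
Qed.

Lemma bm_cvg (F : nat -> T -> R) f (M : R) : (forall n, bm (F n)) ->
  (forall x, F n x @[n --> \oo] --> f x) -> (forall x, `|f x| <= M) -> bm f.
Proof.
move=> bF Ff fM; split; last by exists M.
by apply: (@measurable_fun_cvg _ _ _ _ F) => [n|x _]; [have [] := bF n|exact: Ff].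
Qed.

(* Halving: if 0 <= f <= c then f - (c/2) 1_{f >= c/2} takes values in
   [0, c/2]. *)
Let dyadic_approx (Pr : (T -> R) -> Prop) :
  (forall A, measurable A -> Pr (\1_A)) ->
  (forall (a : R) f h, bm f -> bm h -> Pr f -> Pr h ->
     Pr (fun x => a * f x + h x)) ->
  forall n (c : R) f, 0 <= c -> bm f -> (forall x, 0 <= f x <= c) ->
  exists h, [/\ bm h, Pr h & forall x, 0 <= f x - h x <= c / 2 ^+ n].
Proof.
move=> Pind Plin; elim=> [|n IH] c f c0 bf fc.
  exists (\1_set0); split; [exact: bm_indic|exact: Pind|move=> x].
  by rewrite indic0 subr0 expr0 divr1.
pose A := [set x | c / 2 <= f x].
have mA : measurable A.
  rewrite -[A]setTI -[A]/(f @^-1` [set y | c / 2 <= y]).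
  by apply: (proj1 bf) => //; rewrite -set_itvcy; exact: measurable_itv.
have [||x|h [bh Ph hf]] := IH (c / 2) (fun x => f x - c / 2 * \1_A x).
- by rewrite divr_ge0.
- by apply: bmB => //; apply: bmZ; exact: bm_indic.
- have /andP[f0 f1] := fc x.
  rewrite indicE; have [Ax|nAx] := boolP (x \in A).
    by move: Ax; rewrite inE /A /= => Ax; rewrite mulr1; lra.
  by move: nAx; rewrite notin_setE /A /= => /negP; rewrite -ltNge mulr0; lra.
- exists (fun x => c / 2 * \1_A x + h x); split.
  + by apply: bmD => //; apply: bmZ; exact: bm_indic.
  + by apply: Plin => //; [exact: bm_indic|exact: Pind].
  + move=> x; have := hf x; rewrite exprS invfM mulrA.
    by rewrite opprD addrA.
Qed.

(** Closure under uniform limits suffices because the functions are bounded. Halving needs a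
    nonnegative function, so it is run on f + M, and M is taken back as a multiple of the indicator
    of [setT]. *)
Lemma bm_ind (Pr : (T -> R) -> Prop) :
  (forall A, measurable A -> Pr (\1_A)) ->
  (forall (a : R) f h, bm f -> bm h -> Pr f -> Pr h ->
     Pr (fun x => a * f x + h x)) ->
  (forall f, bm f -> (forall e : R, 0 < e ->
     exists h, [/\ bm h, Pr h & forall x, `|f x - h x| <= e]) -> Pr f) ->
  forall f, bm f -> Pr f.
Proof.
move=> Pind Plin Papp f bf; apply: Papp => // e e0.
have [M fM] := proj2 bf.
have M0 : 0 <= M by apply: le_trans (fM point).
have : (fun n : nat => 2 * M * (2^-1) ^+ n) @ \oo --> (0 : R).
  rewrite -[X in _ --> X](mulr0 (2 * M)); apply: cvgMr.
  by apply: cvg_expr; rewrite ger0_norm// invf_lt1// ltr1n.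
move=> /cvgr0Pnorm_le /(_ e e0) [n _ /(_ n (leqnn n)) /= ne].
have [||x|h [bh Ph hf]] := @dyadic_approx Pr Pind Plin n (2 * M) (fun x => f x + M).
- by rewrite mulr_ge0.
- exact: (bmD bf (bm_cst M)).
- by have := fM x; rewrite ler_norml => /andP[]; lra.
have P1 : Pr (fun x => - M * \1_setT x + h x).
  by apply: Plin => //; [exact: bm_indic|exact: Pind].
exists (fun x => - M * \1_setT x + h x); split => //.
  by apply: bmD => //; apply: bmZ; exact: bm_indic.
move=> x; apply: le_trans ne; rewrite exprVn.
rewrite indicT/= mulr1.
have -> : f x - (- M + h x) = f x + M - h x by ring.
by have /andP[h0 h1] := hf x; rewrite !ger0_norm// (le_trans h0 h1).
Qed.

End bounded_measurable.

Section bm_comp.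
Context d d' (T : measurableType d) (U : measurableType d') (R : realType).

Lemma bm_comp (f : U -> R) (X : T -> U) :
  measurable_fun setT X -> bm f -> bm (fun w => f (X w)).
Proof.
move=> mX [mf [M fM]]; split; last by exists M => x; exact: fM.
exact: (measurableT_comp mf mX).
Qed.

End bm_comp.

(** Real-valued, so that identities between integrals of bounded functions can be closed by [ring]
    and [lra]. The section below asks for mass at most one because [kiter k n] is typed as a
    sub-probability kernel. *)
Definition mean d (T : measurableType d) (R : realType)
  (mu : {measure set T -> \bar R}) (f : T -> R) : R := \int[mu]_x f x.

Section mean.
Context d (T : measurableType d) (R : realType).
Variable mu : {measure set T -> \bar R}.
Hypothesis mu1 : (mu setT <= 1)%E.
Implicit Types f h : T -> R.

Lemma le1_fin_num (A : set T) : measurable A -> mu A \is a fin_num.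
Proof.
move=> mA; rewrite ge0_fin_numE// (@le_lt_trans _ _ 1%E) ?ltry//.
by rewrite (le_trans _ mu1)// le_measure ?inE.
Qed.

Lemma bm_integrable f : bm f -> mu.-integrable setT (EFin \o f).
Proof.
move=> [mf [M fM]]; apply: measurable_bounded_integrable => //.
  by rewrite (le_lt_trans mu1)// ltry.
exists M; split; first exact: num_real.
by move=> x Mx y _ /=; exact: le_trans (fM y) (ltW Mx).
Qed.

Lemma mean_fin f : bm f -> (\int[mu]_x (f x)%:E)%E = (mean mu f)%:E.
Proof.
move=> bf; rewrite /mean /Rintegral fineK//.
exact/integrable_fin_num/bm_integrable.
Qed.

Lemma meanZ (a : R) f : bm f -> mean mu (fun x => a * f x) = a * mean mu f.
Proof. by move=> bf; rewrite /mean RintegralZl//; exact: bm_integrable. Qed.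

Lemma meanD f h : bm f -> bm h ->
  mean mu (fun x => f x + h x) = mean mu f + mean mu h.
Proof.
by move=> bf bh; rewrite /mean RintegralD//; exact: bm_integrable.
Qed.

Lemma meanB f h : bm f -> bm h ->
  mean mu (fun x => f x - h x) = mean mu f - mean mu h.
Proof.
by move=> bf bh; rewrite /mean RintegralB//; exact: bm_integrable.
Qed.

Lemma mean_lin (a : R) f h : bm f -> bm h ->
  mean mu (fun x => a * f x + h x) = a * mean mu f + mean mu h.
Proof. by move=> bf bh; rewrite meanD ?meanZ//; exact: bmZ. Qed.

Lemma mean_le f h : bm f -> bm h -> (forall x, f x <= h x) ->
  mean mu f <= mean mu h.
Proof.
by move=> bf bh fh; apply: le_Rintegral => //; exact: bm_integrable.
Qed.

Lemma mean_indic (A : set T) : measurable A -> mean mu (\1_A) = fine (mu A).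
Proof. by move=> mA; rewrite /mean /Rintegral integral_indic// setIT. Qed.

Lemma mean_abs (c : R) f : bm f -> (forall x, `|f x| <= c) ->
  `|mean mu f| <= c.
Proof.
move=> bf fc; have c0 : 0 <= c by apply: le_trans (fc point).
rewrite (le_trans (le_normr_Rintegral _ _))//; first exact: bm_integrable.
have bnf : bm (fun x => `|f x|).
  split; last by exists c => x; rewrite normr_id.
  by apply: measurableT_comp => //; case: bf.
rewrite (le_trans (mean_le bnf (bm_cst _ c) _))// /mean Rintegral_cst//.
rewrite ler_piMr//; rewrite -lee_fin fineK// ge0_fin_numE//.
by rewrite (le_lt_trans mu1)// ltry.
Qed.

Lemma mean_approx (e : R) f h : bm f -> bm h ->
  (forall x, `|f x - h x| <= e) -> `|mean mu f - mean mu h| <= e.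
Proof. by move=> bf bh fh; rewrite -meanB//; apply: mean_abs => //; exact: bmB. Qed.

End mean.

Lemma mean_cst d (T : measurableType d) (R : realType)
  (mu : {measure set T -> \bar R}) (c : R) :
  mu setT = 1%E -> mean mu (fun=> c) = c.
Proof. by move=> mu1; rewrite /mean Rintegral_cst// mu1 mulr1. Qed.

Lemma mean0 d (T : measurableType d) (R : realType)
  (mu : {measure set T -> \bar R}) : mean mu (fun=> 0) = 0.
Proof. by rewrite /mean Rintegral_cst// mul0r. Qed.

Lemma approx_eq (R : realType) (x y : R) :
  (forall e : R, 0 < e -> `|x - y| <= e) -> x = y.
Proof.
move=> xy; apply/eqP; rewrite -subr_eq0 -normr_le0.
by apply/ler_addgt0Pl => e e0; rewrite addr0; exact: xy.
Qed.

(** The device that turns each hypothesis about sets (iterated kernels, invariance, initial law,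
    conditional probability) into an identity for bounded functions: linearity and Lipschitz
    continuity in the sup norm are all that has to be checked. *)
Lemma bm_functional_ext d (T : measurableType d) (R : realType)
    (Phi Psi : (T -> R) -> R) (C : R) : 0 < C ->
  (forall A, measurable A -> Phi (\1_A) = Psi (\1_A)) ->
  (forall (a : R) f h, bm f -> bm h ->
    Phi (fun x => a * f x + h x) = a * Phi f + Phi h) ->
  (forall (a : R) f h, bm f -> bm h ->
    Psi (fun x => a * f x + h x) = a * Psi f + Psi h) ->
  (forall (e : R) f h, bm f -> bm h -> (forall x, `|f x - h x| <= e) ->
    `|Phi f - Phi h| <= C * e) ->
  (forall (e : R) f h, bm f -> bm h -> (forall x, `|f x - h x| <= e) ->
    `|Psi f - Psi h| <= C * e) ->
  forall f, bm f -> Phi f = Psi f.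
Proof.
move=> C0 PPi Phil Psil Phia Psia; apply: bm_ind => //.
- by move=> a f h bf bh ff hh; rewrite Phil// Psil// ff hh.
- move=> f bf fh; apply: approx_eq => e e0.
  have [|h [bh Ph hf]] := fh (e / (2 * C)); first by rewrite divr_gt0// mulr_gt0.
  have := Phia _ _ _ bf bh hf; have := Psia _ _ _ bf bh hf.
  rewrite Ph !ler_norml.
  have -> : C * (e / (2 * C)) = e / 2 by field; lra.
  lra.
Qed.

(** * Transition operators and conditional expectations *)

Definition kop d (T : measurableType d) (R : realType) (k : R.-pker T ~> T)
  (f : T -> R) : T -> R := fun x => mean (k x) f.

Section kop.
Context d (T : measurableType d) (R : realType).
Variable k : R.-pker T ~> T.
Implicit Types f h : T -> R.

Let k1 x : k x setT = 1%E. Proof. exact: prob_kernel. Qed.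
Let k1le x : (k x setT <= 1)%E. Proof. by rewrite k1. Qed.

Lemma kop_cst (c : R) x : kop k (fun=> c) x = c.
Proof. by rewrite /kop mean_cst. Qed.

Lemma kopD f h x : bm f -> bm h ->
  kop k (fun x => f x + h x) x = kop k f x + kop k h x.
Proof. by move=> bf bh; exact: meanD. Qed.

Lemma kopB f h x : bm f -> bm h ->
  kop k (fun x => f x - h x) x = kop k f x - kop k h x.
Proof. by move=> bf bh; exact: meanB. Qed.

Lemma kopZ (a : R) f x : bm f -> kop k (fun x => a * f x) x = a * kop k f x.
Proof. by move=> bf; exact: meanZ. Qed.

Lemma kop_abs (c : R) f x : bm f -> (forall x, `|f x| <= c) ->
  `|kop k f x| <= c.
Proof. by move=> bf fc; exact: mean_abs. Qed.

Lemma bm_kop f : bm f -> bm (kop k f).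
Proof.
move: f; apply: bm_ind => [A mA|a f h bf bh bkf bkh|f bf fh].
- split; last first.
    exists 1 => x; apply: kop_abs; first exact: bm_indic.
    by move=> y; rewrite indicE; case: (_ \in _); rewrite ?normr0 ?normr1.
  rewrite (_ : kop k _ = fine \o (fun x => k x A)); last first.
    by apply/funext => x; rewrite /kop mean_indic.
  by apply: measurableT_comp => //; exact: measurable_kernel.
- rewrite (_ : kop k _ = fun x => a * kop k f x + kop k h x); last first.
    by apply/funext => x; rewrite /kop mean_lin.
  by apply: bmD => //; exact: bmZ.
- have fn n : {h | [/\ bm h, bm (kop k h) & forall x, `|f x - h x| <= n.+1%:R^-1]}.
    by apply/cid/fh; rewrite invr_gt0.
  have [M fM] := proj2 bf.
  apply: (@bm_cvg _ _ _ (fun n => kop k (sval (fn n))) _ M) => [n|x|x].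
  + by case: (fn n) => h [].
  + apply/cvgrPdist_le => e e0; near=> n.
    case: (fn n) => h [bh _ hf] /=.
    apply: (le_trans (mean_approx (k1le x) bf bh hf)).
    by apply/ltW; near: n; exact: (near_infty_natSinv_lt (PosNum e0)).
  + exact: kop_abs.
Unshelve. all: end_near. Qed.

Lemma bm_iter_kop n f : bm f -> bm (iter n (kop k) f).
Proof. by move=> bf; elim: n => //= n; exact: bm_kop. Qed.

Lemma iter_kop_abs n (c : R) f x : bm f -> (forall x, `|f x| <= c) ->
  `|iter n (kop k) f x| <= c.
Proof.
move=> bf fc; elim: n x => [|n IH] x //=; apply: kop_abs => //.
exact: bm_iter_kop.
Qed.

Lemma iter_kop_cst n (c : R) : iter n (kop k) (fun=> c) = fun=> c.
Proof. by elim: n => //= n ->; apply/funext => x; exact: kop_cst. Qed.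

Lemma iter_kopB n f h : bm f -> bm h ->
  iter n (kop k) (fun x => f x - h x) =
  fun x => iter n (kop k) f x - iter n (kop k) h x.
Proof.
move=> bf bh; elim: n => //= n ->; apply/funext => x.
by rewrite kopB//; exact: bm_iter_kop.
Qed.

Lemma iter_kopD n f h : bm f -> bm h ->
  iter n (kop k) (fun x => f x + h x) =
  fun x => iter n (kop k) f x + iter n (kop k) h x.
Proof.
move=> bf bh; elim: n => //= n ->; apply/funext => x.
by rewrite kopD//; exact: bm_iter_kop.
Qed.

Lemma kiter1 n x : (kiter k n x setT <= 1)%E.
Proof. exact: sprob_kernel_le1. Qed.

(** The mixing hypothesis speaks of the kernel [kiter], the analysis of powers of [kop]. Both peel
    off the first transition, so on an indicator the induction hypothesis applies under the integral
    over the first state. *)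
Lemma mean_kiter n f x : bm f -> mean (kiter k n x) f = iter n (kop k) f x.
Proof.
elim: n x f => [|n IH] x f bf.
  rewrite /mean /Rintegral /= integral_dirac//=.
    by rewrite indicT mul1r.
  by apply/measurable_EFinP; case: bf.
rewrite iterSr.
have -> : iter n (kop k) (kop k f) x = kop k (iter n (kop k) f) x.
  by rewrite -iterSr.
have kn1 := kiter1 n.+1 x.
pose Psi h := kop k (iter n (kop k) h) x.
apply: (@bm_functional_ext _ _ _ (mean (kiter k n.+1 x)) Psi 1) => //.
- move=> A mA; rewrite mean_indic//= /Psi /kop /mean /Rintegral.
  congr fine.
  apply: eq_integral => y _.
  rewrite -IH; last exact: bm_indic.
  by rewrite mean_indic// fineK// le1_fin_num// kiter1.
- by move=> a f' h bf' bh; rewrite mean_lin.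
- move=> a f' h bf' bh; rewrite /Psi -kopZ; last exact: bm_iter_kop.
  rewrite -kopD; [|exact/bmZ/bm_iter_kop|exact: bm_iter_kop].
  congr (kop k _ x).
  elim: (n) => //= j ->; apply/funext => y.
  by rewrite kopD ?kopZ//; [exact: bm_iter_kop|exact/bmZ/bm_iter_kop|exact: bm_iter_kop].
- by move=> e f' h bf' bh fh; rewrite mul1r; exact: mean_approx.
- move=> e f' h bf' bh fh; rewrite mul1r /Psi -kopB; [|exact: bm_iter_kop..].
  rewrite -iter_kopB//.
  by apply: kop_abs => [|y]; [apply: bm_iter_kop; exact: bmB|apply: iter_kop_abs => //; exact: bmB].
Qed.

Lemma mean_invariant (mu : probability T R) f : invariant_measure k mu ->
  bm f -> mean mu (kop k f) = mean mu f.
Proof.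
move=> kmu.
have mu1 : (mu setT <= 1)%E by rewrite probability_setT.
apply: (@bm_functional_ext _ _ _ (mean mu \o kop k) (mean mu) 1) => //=.
- move=> A mA; rewrite [RHS]mean_indic//.
  transitivity (fine (\int[mu]_x k x A)%E); last by congr fine; exact: kmu.
  rewrite /mean /Rintegral; congr fine; apply: eq_integral => x _.
  by rewrite /kop mean_indic// fineK// le1_fin_num.
- move=> a f' h bf' bh; rewrite -mean_lin//; [|exact: bm_kop..].
  by congr mean; apply/funext => x; rewrite /kop mean_lin.
- by move=> a f' h bf' bh; rewrite mean_lin.
- move=> e f' h bf' bh fh; rewrite mul1r; apply: mean_approx => //; [exact: bm_kop..|].
  by move=> x; exact: mean_approx.
- by move=> e f' h bf' bh fh; rewrite mul1r; exact: mean_approx.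
Qed.

Lemma mean_iter_invariant (mu : probability T R) f n : invariant_measure k mu ->
  bm f -> mean mu (iter n (kop k) f) = mean mu f.
Proof.
move=> kmu bf; elim: n => //= n IH; rewrite mean_invariant//.
exact: bm_iter_kop.
Qed.

End kop.

Lemma tv_dist_mean d (T : measurableType d) (R : realType)
    (mu nu : {measure set T -> \bar R}) (e M : R) (f : T -> R) :
  (mu setT <= 1)%E -> (nu setT <= 1)%E -> (tv_dist mu nu <= e%:E)%E ->
  bm f -> (forall x, `|f x| <= M) -> `|mean mu f - mean nu f| <= e * M.
Proof.
move=> mu1 nu1 mne bf fM.
(* Normalising by M needs M > 0; otherwise f and M both vanish. *)
have [M0|M0] := leP M 0.
  have f0 : f = fun=> 0.
    by apply/funext => x; apply/eqP; rewrite -normr_le0 (le_trans (fM x)).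
  have -> : M = 0.
    by apply/eqP; rewrite eq_le M0 (le_trans _ (fM point)).
  by rewrite mulr0 f0 /mean !Rintegral_cst// !mul0r subrr normr0.
have bf' : bm (fun x => M^-1 * f x) := bmZ _ bf.
rewrite -ler_pdivrMr// mulrC -[X in X * _](gtr0_norm (_ : 0 < M^-1)) ?invr_gt0//.
rewrite -normrM mulrBr -!meanZ// -lee_fin; apply: le_trans mne.
apply: ereal_sup_ubound; exists (fun x => M^-1 * f x).
  split; first by case: bf'.
  by move=> x; rewrite normrM gtr0_norm ?invr_gt0// ler_pdivrMl// mulr1.
by rewrite !mean_fin// -EFinB abse_EFin.
Qed.

(** * Conditioning on the past of the chain *)

Section conditional_mean.
Context d (Omega : measurableType d) d' (T : measurableType d') (R : realType).
Variables (P : probability Omega R) (X : nat -> {RV P >-> T}).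
Implicit Types (Psi : Omega -> R) (F : T -> R).

Let P1 : (P setT <= 1)%E. Proof. by rewrite probability_setT. Qed.

Definition past_gen (k : nat) : set (set Omega) :=
  \bigcup_(i in `I_k) preimage_set_system setT (X i) measurable.

(** Taking the past as the sigma-algebra of a measurable type makes every lemma on [bm], the
    induction principle included, available for functions of the past. *)
Definition past_bm (k : nat) Psi := bm (T := g_sigma_algebraType (past_gen k)) Psi.

Lemma bm_rv i F : bm F -> bm (fun w => F (X i w)).
Proof. by apply: bm_comp; exact: measurable_funPT. Qed.

Lemma past_rv k i F : (i < k)%N -> bm F -> past_bm k (fun w => F (X i w)).
Proof.
move=> ik; apply: bm_comp => _ Y mY.
by apply: sub_sigma_algebra; exists i => //; exists Y.
Qed.

Lemma sigma_past_measurable k A : sigma_past X k A -> measurable A.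
Proof.
apply: smallest_sub; first exact: sigma_algebra_measurable.
by move=> _ [i _] [Y mY <-]; exact: measurable_funPT.
Qed.

Lemma past_bm_bm k Psi : past_bm k Psi -> bm Psi.
Proof.
move=> [mPsi bPsi]; split => // _ Y mY.
by apply: (@sigma_past_measurable k); exact: mPsi.
Qed.

Let mean_indicM (H : set Omega) (f : Omega -> R) :
  mean P (fun w => \1_H w * f w) = \int[P]_(w in H) f w.
Proof.
rewrite Rintegral_mkcond /mean; congr Rintegral; apply/funext => w.
by rewrite patchE indicE; case: (_ \in _); rewrite ?mul1r ?mul0r.
Qed.

Variables (Q : nat -> R.-pker T ~> T) (mu : probability T R) (n : nat).
Hypothesis XQ : markov_chain Q mu n X.

Lemma mean_init F : bm F -> mean P (fun w => F (X 0%N w)) = mean mu F.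
Proof.
have mu1 : (mu setT <= 1)%E by rewrite probability_setT.
apply: (@bm_functional_ext _ _ _ (fun F => mean P (fun w => F (X 0%N w)))
  (mean mu) 1) => //.
- move=> A mA; rewrite [RHS]mean_indic//.
  rewrite [LHS](_ : _ = mean P \1_(X 0%N @^-1` A)).
    rewrite mean_indic; first by congr fine; exact: XQ.1.
    by rewrite -[X in measurable X]setTI; exact: measurable_funPT.
  by congr mean; apply/funext => w; rewrite !indicE.
- by move=> a f h bf bh; rewrite mean_lin//; exact: bm_rv.
- by move=> a f h bf bh; rewrite mean_lin.
- move=> e f h bf bh fh; rewrite mul1r; apply: mean_approx => //; exact: bm_rv.
- by move=> e f h bf bh fh; rewrite mul1r; exact: mean_approx.
Qed.

(** Two nested extensions. The conditional probability gives the identity for a past event [H] and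
    an indicator of [X k]; with [H] fixed it extends to all bounded F, and then from indicators of
    past events to all bounded Psi. *)
Lemma cond_mean k Psi F : (1 <= k <= n)%N -> past_bm k Psi -> bm F ->
  mean P (fun w => Psi w * F (X k w)) =
  mean P (fun w => Psi w * kop (Q k) F (X k.-1 w)).
Proof.
move=> kn bPsi bF; have bQF := bm_kop (Q k) bF.
have lin h (bh : bm h) (a : R) f g : past_bm k f -> past_bm k g ->
    mean P (fun w => (a * f w + g w) * h w) =
    a * mean P (fun w => f w * h w) + mean P (fun w => g w * h w).
  move=> /past_bm_bm bf /past_bm_bm bg.
  by rewrite -mean_lin; [congr mean; apply/funext => w; ring|
    |exact: bmM|exact: bmM].
have app h (bh : bm h) (C : R) (hC : forall w, `|h w| <= C) (e : R) f g :
    past_bm k f -> past_bm k g -> (forall w, `|f w - g w| <= e) ->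
    `|mean P (fun w => f w * h w) - mean P (fun w => g w * h w)| <= C * e.
  move=> /past_bm_bm bf /past_bm_bm bg fg.
  apply: mean_approx => //; [exact: bmM|exact: bmM|move=> w].
  by rewrite -mulrBl normrM mulrC ler_pM.
have [C FC] := proj2 bF.
(* The extension lemma wants a positive Lipschitz constant, whereas the bound C may be 0. *)
have C1 (z : R) : `|z| <= C -> `|z| <= `|C| + 1.
  by move=> /le_trans; apply; rewrite (le_trans (ler_norm _))// lerDl.
move: Psi bPsi.
apply: (@bm_functional_ext _ (g_sigma_algebraType (past_gen k)) R
  (fun Psi => mean P (fun w => Psi w * F (X k w)))
  (fun Psi => mean P (fun w => Psi w * kop (Q k) F (X k.-1 w)))
  (`|C| + 1)) => [|H mH|a f g bf bg|a f g bf bg|e f g bf bg|e f g bf bg].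
- by rewrite ltr_wpDl.
- have pH : sigma_past X k H by [].
  have mH' := sigma_past_measurable pH.
  move: F bF {bQF FC C1 C}.
  have bH : bm (\1_H : Omega -> R) by exact: bm_indic.
  have H1 w : `|\1_H w : R| <= 1.
    by rewrite indicE; case: (_ \in _); rewrite ?normr0 ?normr1.
  apply: (@bm_functional_ext _ _ _
    (fun F => mean P (fun w => \1_H w * F (X k w)))
    (fun F => mean P (fun w => \1_H w * kop (Q k) F (X k.-1 w))) 1) => //.
  + move=> A mA; have mXA : measurable (X k @^-1` A).
      by rewrite -[X in measurable X]setTI; exact: measurable_funPT.
    have := (XQ.2 k kn A mA).2 H pH => QH.
    rewrite [LHS](_ : _ = mean P \1_(H `&` X k @^-1` A)); last first.
      by congr mean; apply/funext => w; rewrite indicI/= !indicE.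
    rewrite mean_indic; last exact: measurableI.
    transitivity (fine (\int[P]_(w in H) Q k (X k.-1 w) A)%E).
      by congr fine; exact/esym.
    rewrite mean_indicM /Rintegral; congr fine; apply: eq_integral => w _.
    by rewrite /kop mean_indic// fineK// le1_fin_num// prob_kernel.
  + move=> a f h bf bh; cbv beta; rewrite -mean_lin; [|by []|by apply: bmM => //; exact: bm_rv..].
    by congr mean; apply/funext => w; ring.
  + move=> a f h bf bh; cbv beta; rewrite -mean_lin; [|by []|by apply: bmM => //; apply: bm_rv; exact: bm_kop..].
    congr mean; apply/funext => w; rewrite kopD ?kopZ//; [by ring|exact: bmZ].
  + move=> e f h bf bh fh; rewrite mul1r; apply: mean_approx => //.
    * by apply: bmM => //; exact: bm_rv.
    * by apply: bmM => //; exact: bm_rv.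
    * by move=> w; rewrite -mulrBr normrM -[e]mul1r ler_pM.
  + move=> e f h bf bh fh; rewrite mul1r; apply: mean_approx => //.
    * by apply: bmM => //; apply: bm_rv; exact: bm_kop.
    * by apply: bmM => //; apply: bm_rv; exact: bm_kop.
    * move=> w; rewrite -mulrBr normrM -[e]mul1r ler_pM// -kopB//.
      by apply: kop_abs => //; exact: bmB.
- by apply: lin => //; exact: bm_rv.
- by apply: lin => //; exact: bm_rv.
- by apply: app => // [|w]; [exact: bm_rv|exact: C1].
- apply: app => // [|w]; first exact: bm_rv.
  by apply: C1; exact: kop_abs.
Qed.

End conditional_mean.

(** * Mixing and the Poisson equation *)

Section geometric.
Context (R : realType).
Variables (q : R) (q01 : 0 < q < 1).
Implicit Types (u : nat -> R) (A : R).

Let q_lt1 : q < 1. Proof. by case/andP: q01. Qed.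
Let q_gt0 : 0 < q. Proof. by case/andP: q01. Qed.
Let q_neq1 : 0 < 1 - q. Proof. by rewrite subr_gt0. Qed.

(** Lets infinite series be treated through partial sums: a relation that holds up to a geometric
    error for every n is exact. *)
Lemma geo_le (x y A : R) : (forall n, x <= y + A * q ^+ n) -> x <= y.
Proof.
move=> xy; have yA : (fun n => y + A * q ^+ n) @ \oo --> y.
  rewrite -[X in _ --> X]addr0 -(mulr0 A); apply: cvgD; first exact: cvg_cst.
  by apply: cvgMr; apply: cvg_expr; rewrite gtr0_norm.
rewrite -(cvg_lim (@Rhausdorff R) yA); apply: limr_ge; first by apply/cvg_ex; exists y.
by near=> n; exact: xy.
Unshelve. all: end_near. Qed.

Lemma geo_eq (x y A : R) : (forall n, `|x - y| <= A * q ^+ n) -> x = y.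
Proof.
move=> xy; apply/eqP; rewrite -subr_eq0 -normr_le0.
by apply: (@geo_le _ _ A) => n; rewrite add0r.
Qed.

Lemma geo_sum u A n N : 0 <= A -> (forall j, `|u j| <= A * q ^+ j) -> (n <= N)%N ->
  `|\sum_(n <= j < N) u j| <= A / (1 - q) * q ^+ n.
Proof.
(* Keeping the exact value of the geometric sum is what makes the induction on N go through. *)
move=> A0 uA nN; apply: (@le_trans _ _ (A / (1 - q) * (q ^+ n - q ^+ N))).
  move: N nN; elim=> [|N IH] nN.
    move: nN; rewrite leqn0 => /eqP ->.
    by rewrite big_geq// normr0 subrr mulr0.
  move: nN; rewrite leq_eqVlt => /orP[/eqP <-|nN].
    by rewrite big_geq// normr0 subrr mulr0.
  rewrite big_nat_recr//= (le_trans (ler_normD _ _))//.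
  rewrite (le_trans (lerD (IH nN) (uA N)))// exprS.
  rewrite [leLHS](_ : _ = A / (1 - q) * (q ^+ n - q * q ^+ N))//.
  move: (q ^+ n) (q ^+ N) => a b; field; by rewrite gt_eqF.
apply: ler_wpM2l; first by rewrite divr_ge0// ltW.
by rewrite lerBlDr lerDl exprn_ge0// ltW.
Qed.

Lemma geo_cvg u A : 0 <= A -> (forall j, `|u j| <= A * q ^+ j) ->
  cvgn (series u).
Proof.
move=> A0 uA; apply: normed_cvg; apply: (@series_le_cvg _ _ (geometric A q)).
- by move=> n; exact: normr_ge0.
- by move=> n; rewrite /= mulr_ge0// exprn_ge0// ltW.
- exact: uA.
- by apply: is_cvg_geometric_series; rewrite gtr0_norm.
Qed.

Lemma geo_lim u A n : 0 <= A -> (forall j, `|u j| <= A * q ^+ j) ->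
  `|limn (series u) - \sum_(0 <= j < n) u j| <= A / (1 - q) * q ^+ n.
Proof.
move=> A0 uA; have uc := geo_cvg A0 uA.
have uN N : (n <= N)%N -> `|series u N - \sum_(0 <= j < n) u j| <= A / (1 - q) * q ^+ n.
  move=> nN; rewrite /series/= (big_cat_nat (leq0n n) nN)//=.
  by rewrite addrAC subrr add0r; exact: geo_sum.
rewrite ler_distl; apply/andP; split.
  apply: limr_ge => //; near=> N; have := uN N.
  by rewrite ler_distl => /(_ _)/andP[]//; near: N; exact: nbhs_infty_ge.
apply: limr_le => //; near=> N; have := uN N.
by rewrite ler_distl => /(_ _)/andP[]//; near: N; exact: nbhs_infty_ge.
Unshelve. all: end_near. Qed.

End geometric.

Section mixing.
Context d (T : measurableType d) (R : realType).
Variables (k : R.-pker T ~> T) (r : R) (m : nat).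
Hypotheses (m0 : (0 < m)%N) (r01 : 0 < r < 1).
Hypothesis mix : forall (f : T -> R) (M : R) x y, bm f ->
  (forall x, `|f x| <= M) ->
  `|iter m (kop k) f x - iter m (kop k) f y| <= r * M.

(** Subtracting the constant f [point] turns a sup bound into an oscillation bound. Oscillation,
    unlike the sup norm, is contracted by the operator, so the estimate can be iterated. *)
Lemma mix_osc (f : T -> R) (w : R) x y : bm f -> (forall x y, `|f x - f y| <= w) ->
  `|iter m (kop k) f x - iter m (kop k) f y| <= r * w.
Proof.
move=> bf fw; have := @mix (fun z => f z - f point) w x y (bmB bf (bm_cst _ _)).
rewrite iter_kopB//; last exact: bm_cst.
rewrite iter_kop_cst; rewrite (_ : _ - _ - _ = iter m (kop k) f x - iter m (kop k) f y).
  by apply=> z; exact: fw.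
by ring.
Qed.

Lemma iter_mix_osc j (f : T -> R) (w : R) x y : bm f ->
  (forall x y, `|f x - f y| <= w) ->
  `|iter (m * j) (kop k) f x - iter (m * j) (kop k) f y| <= r ^+ j * w.
Proof.
move=> bf fw; elim: j x y => [|j IH] x y; first by rewrite muln0 mul1r.
rewrite mulnS iterD exprS -mulrA; apply: mix_osc => //.
exact: bm_iter_kop.
Qed.

(** The m-th root of r, the rate per single step. *)
Definition mix_ratio : R := r `^ m%:R^-1.

Lemma mix_ratioX : mix_ratio ^+ m = r.
Proof.
case/andP: r01 => r0 _.
rewrite -powR_mulrn ?powR_ge0// -powRrM mulVf ?powRr1// ?ltW//.
by rewrite pnatr_eq0 -lt0n.
Qed.

Lemma mix_ratio01 : 0 < mix_ratio < 1.
Proof.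
case/andP: r01 => r0 r1; rewrite powR_gt0//=.
rewrite -(@ltr_pXn2r _ m)// ?nnegrE ?powR_ge0//.
by rewrite mix_ratioX expr1n.
Qed.

(** By invariance mu f is the average of Q^n f, so only differences of Q^n f between two points
    matter. These contract by r once every m steps; the n mod m steps left over cost the factor 1 /
    r, and the 2 bounds the oscillation by 2 M. *)
Lemma kop_ergodic (mu : probability T R) (f : T -> R) (M : R) n x :
  invariant_measure k mu -> bm f -> (forall x, `|f x| <= M) ->
  `|iter n (kop k) f x - mean mu f| <= 2 / r * mix_ratio ^+ n * M.
Proof.
case/andP: r01 => r0 r1 kmu bf fM.
have mu1 : mu setT = 1%E by rewrite probability_setT.
have mu1' : (mu setT <= 1)%E by rewrite mu1.
have M0 : 0 <= M by rewrite (le_trans _ (fM point)).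
have bn := bm_iter_kop k n bf.
rewrite -(mean_iter_invariant n kmu bf) -(mean_cst (iter n (kop k) f x) mu1).
apply: mean_approx => //; first exact: bm_cst.
move=> y; rewrite (divn_eq n m) addnC mulnC addnC iterD.
apply: (@le_trans _ _ (r ^+ (n %/ m) * (M + M))).
  apply: iter_mix_osc; first exact: bm_iter_kop.
  move=> z t; rewrite (le_trans (ler_normB _ _))// lerD//; exact: iter_kop_abs.
have -> : M + M = 2 * M by ring.
rewrite [leRHS](_ : _ = mix_ratio ^+ (m * (n %/ m) + n %% m) / r * (2 * M)); last by ring.
rewrite ler_wpM2r ?mulr_ge0// ler_pdivlMr// exprD exprM mix_ratioX.
apply: ler_wpM2l; first by rewrite exprn_ge0// ltW.
rewrite -[leLHS]mix_ratioX.
have /andP[q0 q1] := mix_ratio01.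
by apply: ler_wiXn2l; [exact: ltW|exact: ltW|rewrite ltnW// ltn_mod].
Qed.

End mixing.

Section poisson.
Context d (T : measurableType d) (R : realType).
Variables (k : R.-pker T ~> T) (mu : probability T R) (C q : R).
Hypotheses (q01 : 0 < q < 1) (C0 : 0 <= C) (kmu : invariant_measure k mu).
Hypothesis erg : forall (f : T -> R) (M : R) n x, bm f -> (forall x, `|f x| <= M) ->
  `|iter n (kop k) f x - mean mu f| <= C * q ^+ n * M.

Let mu1 : mu setT = 1%E. Proof. by rewrite probability_setT. Qed.
Let mu1' : (mu setT <= 1)%E. Proof. by rewrite mu1. Qed.

(** The mean is removed inside each term, so that observables need not be centred beforehand. *)
Definition poisson_term (f : T -> R) j x := iter j.+1 (kop k) f x - mean mu f.

Definition poisson (f : T -> R) x := limn (series (fun j => poisson_term f j x)).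

Variables (f : T -> R) (M : R).
Hypotheses (bf : bm f) (fM : forall x, `|f x| <= M).

Let M0 : 0 <= M. Proof. exact: le_trans (fM point). Qed.

Let CM0 : 0 <= C * M. Proof. exact: mulr_ge0. Qed.

Let term_le j x : `|poisson_term f j x| <= C * M * q ^+ j.
Proof.
case/andP: q01 => q0 q1; apply: (le_trans (erg j.+1 x bf fM)).
rewrite exprS -!mulrA ler_wpM2l// mulrCA [M * _]mulrC mulrA mulrAC.
apply: ler_piMr; last exact: ltW.
by rewrite mulr_ge0// exprn_ge0// ltW.
Qed.

Lemma bm_poisson_term j : bm (poisson_term f j).
Proof. by apply: bmB; [exact: bm_iter_kop|exact: bm_cst]. Qed.

Lemma bm_poisson_sum n : bm (fun x => \sum_(0 <= j < n) poisson_term f j x).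
Proof. by apply: bm_sum => j _; exact: bm_poisson_term. Qed.

Lemma poisson_approx n x :
  `|poisson f x - \sum_(0 <= j < n) poisson_term f j x| <= C / (1 - q) * M * q ^+ n.
Proof.
have := geo_lim q01 n CM0 (term_le^~ x).
by rewrite (_ : C * M / (1 - q) = C / (1 - q) * M)//; ring.
Qed.

Lemma poisson_abs x : `|poisson f x| <= C / (1 - q) * M.
Proof. by have := poisson_approx 0 x; rewrite big_nil subr0 mulr1. Qed.

Lemma bm_poisson : bm (poisson f).
Proof.
apply: (bm_cvg (fun n => bm_poisson_sum n) _ poisson_abs) => x.
exact: (@geo_cvg _ q q01 (fun j => poisson_term f j x) (C * M)).
Qed.

(** [kop k] shifts the partial sums by one index. Truncating the series costs one geometric tail
    inside the operator and one outside, hence the 2. *)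
Lemma poissonE x :
  kop k (fun y => f y + poisson f y) x = poisson f x + mean mu f.
Proof.
rewrite kopD//; last exact: bm_poisson.
apply: (@geo_eq _ q q01 _ _ (2 * (C / (1 - q) * M))) => n.
set s := fun x => \sum_(0 <= j < n) poisson_term f j x.
have ks : kop k s x = \sum_(0 <= j < n) poisson_term f j.+1 x.
  rewrite {}/s; elim: n => [|n IH].
    under [X in kop k X]funext do rewrite big_nil.
    by rewrite big_nil kop_cst.
  under [X in kop k X]funext do rewrite big_nat_recr//=.
  rewrite kopD; [|exact: bm_poisson_sum|exact: bm_poisson_term].
  rewrite IH big_nat_recr//=; congr (_ + _).
  rewrite /poisson_term kopB ?kop_cst//; [exact: (bm_iter_kop k n.+1 bf)|exact: bm_cst].
have kp := mean_approx (_ : (k x setT <= 1)%E) bm_poisson (bm_poisson_sum n)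
  (poisson_approx n).
rewrite prob_kernel in kp; have {}kp := kp (lexx _).
have p1 := poisson_approx n.+1 x.
have q1 : C / (1 - q) * M * q ^+ n.+1 <= C / (1 - q) * M * q ^+ n.
  case/andP: q01 => q0 q1; apply: ler_wpM2l.
    by rewrite mulr_ge0// divr_ge0// subr_ge0 ltW.
  by rewrite exprS ler_piMl// ?exprn_ge0// ltW.
move: kp; rewrite -/(kop k (poisson f) x) -/(kop k s x) ks => kp.
move: p1; rewrite big_nat_recl// [poisson_term f 0 x]/poisson_term/= => p1.
rewrite (_ : _ - _ = (kop k (poisson f) x - \sum_(0 <= j < n) poisson_term f j.+1 x)
   - (poisson f x - (kop k f x - mean mu f + \sum_(0 <= j < n) poisson_term f j.+1 x)));
  last by ring.
rewrite (le_trans (ler_normB _ _))// -[2 * _ * _]mulrA mulr_natl mulr2n lerD//.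
exact: le_trans p1 q1.
Qed.

Lemma mean_poisson : mean mu (poisson f) = 0.
Proof.
apply: (@geo_eq _ q q01 _ _ (C / (1 - q) * M)) => n.
have := mean_approx mu1' bm_poisson (bm_poisson_sum n) (poisson_approx n).
rewrite (_ : mean mu (fun x => \sum_(0 <= j < n) _) = 0)//.
elim: n => [|n IH].
  by under [X in mean mu X]funext do rewrite big_nil; rewrite mean_cst.
under [X in mean mu X]funext do rewrite big_nat_recr//=.
rewrite meanD//; [|exact: bm_poisson_sum|exact: bm_poisson_term].
rewrite IH add0r /poisson_term meanB//; [|exact: (bm_iter_kop k n.+1 bf)|exact: bm_cst].
by rewrite mean_cst// (mean_iter_invariant n.+1)// subrr.
Qed.

(* G is centred because mu is invariant, so D is, up to a constant, the sum of
   the Q^j G. *)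
Lemma poisson_unique (D G : T -> R) (e : R) : bm D -> bm G ->
  (forall x, D x = kop k D x + G x) -> (forall x, `|G x| <= e) ->
  forall x, `|D x - mean mu D| <= C / (1 - q) * e.
Proof.
move=> bD bG DG Ge x.
have e0 : 0 <= e by exact: le_trans (Ge point).
have G0 : mean mu G = 0.
  have -> : G = fun x => D x - kop k D x.
    by apply/funext => y; rewrite DG addrAC subrr add0r.
  by rewrite meanB//; [rewrite mean_invariant// subrr|exact: bm_kop].
have Dn n y : D y = iter n (kop k) D y + \sum_(0 <= j < n) iter j (kop k) G y.
  elim: n => [|n IH]; first by rewrite big_nil addr0.
  have E : iter n (kop k) D y = iter n.+1 (kop k) D y + iter n (kop k) G y.
    rewrite {1}(_ : D = fun x => kop k D x + G x); last exact/funext.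
    by rewrite iter_kopD//; [rewrite -iterSr|exact: bm_kop].
  rewrite [LHS]IH big_nat_recr// E /=; ring.
have [N DN] := proj2 bD.
apply: (@geo_le _ q q01 _ _ (C * N)) => n.
rewrite {1}(Dn n x) addrAC addrC (le_trans (ler_normD _ _))// lerD//; last first.
  by rewrite mulrAC; exact: erg.
rewrite (le_trans (@geo_sum _ q q01 _ (C * e) 0 n _ _ _))//; first exact: mulr_ge0.
  by move=> j; have := erg j x bG Ge; rewrite G0 subr0 mulrAC.
by rewrite mulr1 mulrAC.
Qed.

End poisson.

(** * Lipschitz dependence on the parameter *)

Section family.
Context d (T : measurableType d) (R : realType).
Variables (k : R -> R.-pker T ~> T) (mu : R -> probability T R) (C q L : R).
Hypotheses (q01 : 0 < q < 1) (C0 : 0 <= C) (L0 : 0 <= L).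
Hypothesis kmu : forall u : R, u \in `[0, 1] -> invariant_measure (k u) (mu u).
Hypothesis erg : forall (u : R) (f : T -> R) (M : R) n x, u \in `[0, 1] ->
  bm f -> (forall x, `|f x| <= M) ->
  `|iter n (kop (k u)) f x - mean (mu u) f| <= C * q ^+ n * M.
Hypothesis klip : forall (u v : R) (f : T -> R) (M : R) x,
  u \in `[0, 1] -> v \in `[0, 1] -> bm f -> (forall x, `|f x| <= M) ->
  `|kop (k u) f x - kop (k v) f x| <= L * `|u - v| * M.

Let mu1 u : (mu u setT <= 1)%E. Proof. by rewrite probability_setT. Qed.
Let D := C / (1 - q).
Let D0 : 0 <= D.
Proof. by case/andP: q01 => _ q1; rewrite divr_ge0// subr_ge0 ltW. Qed.

(** With h = f + phi_u, the Poisson equation at u and the invariance of mu_v give mu_u f - mu_v f =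
    mu_v (Q_u h - Q_v h), and h is bounded by (1 + D) M. *)
Lemma mean_lip (u v : R) (f : T -> R) (M : R) : u \in `[0, 1] -> v \in `[0, 1] ->
  bm f -> (forall x, `|f x| <= M) ->
  `|mean (mu u) f - mean (mu v) f| <= L * (1 + D) * M * `|u - v|.
Proof.
move=> uI vI bf fM.
have bp := bm_poisson q01 C0 (fun f M n x => @erg u f M n x uI) bf fM.
have pM := poisson_abs q01 C0 (fun f M n x => @erg u f M n x uI) bf fM.
have bh := bmD bf bp.
have hM x : `|f x + poisson (k u) (mu u) f x| <= (1 + D) * M.
  by rewrite (le_trans (ler_normD _ _))// mulrDl mul1r lerD.
have -> : mean (mu u) f - mean (mu v) f =
    mean (mu v) (kop (k u) (fun x => f x + poisson (k u) (mu u) f x)) -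
    mean (mu v) (kop (k v) (fun x => f x + poisson (k u) (mu u) f x)).
  rewrite (mean_invariant (kmu vI))// (_ : kop (k u) _ =
      fun x => poisson (k u) (mu u) f x + mean (mu u) f); last first.
    by apply/funext => x; exact: (poissonE q01 C0 (fun f M n x => @erg u f M n x uI) bf fM).
  rewrite (meanD (mu1 v) bf bp) (meanD (mu1 v) bp (bm_cst _ _)).
  by rewrite mean_cst; [ring|exact: probability_setT].
apply: (mean_approx (mu1 v)); [exact: bm_kop|exact: bm_kop|move=> x].
apply: (le_trans (klip x uI vI bh hM)).
by rewrite le_eqVlt; apply/orP; left; apply/eqP; ring.
Qed.

(** Closed under sums, products, averages against [mu u] and Poisson series, so every corrector
    inherits the regularity of the observable and explicit constants need not be tracked. *)
Definition lipfam (F : R -> T -> R) := exists M N : R, [/\ 0 <= M, 0 <= N &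
  forall u : R, u \in `[0, 1] -> [/\ bm (F u), forall x, `|F u x| <= M &
    forall v : R, v \in `[0, 1] -> forall x, `|F u x - F v x| <= N * `|u - v|]].

Lemma lipfamD F G : lipfam F -> lipfam G -> lipfam (fun u x => F u x + G u x).
Proof.
move=> [M [N [M0 N0 FMN]]] [M' [N' [M0' N0' GMN]]].
exists (M + M'), (N + N'); split; [exact: addr_ge0|exact: addr_ge0|].
move=> u uI; have [bF FM FN] := FMN u uI; have [bG GM GN] := GMN u uI.
split=> [|x|v vI x]; first exact: bmD.
  by rewrite (le_trans (ler_normD _ _))// lerD.
rewrite (_ : _ - _ = (F u x - F v x) + (G u x - G v x)); last by ring.
by rewrite (le_trans (ler_normD _ _))// mulrDl lerD// ?FN ?GN.
Qed.

Lemma lipfamM F G : lipfam F -> lipfam G -> lipfam (fun u x => F u x * G u x).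
Proof.
move=> [M [N [M0 N0 FMN]]] [M' [N' [M0' N0' GMN]]].
exists (M * M'), (M * N' + N * M'); split; rewrite ?addr_ge0 ?mulr_ge0//.
move=> u uI; have [bF FM FN] := FMN u uI; have [bG GM GN] := GMN u uI.
split=> [|x|v vI x]; first exact: bmM.
  by rewrite normrM ler_pM.
have [_ GM' _] := GMN v vI.
rewrite (_ : _ - _ = F u x * (G u x - G v x) + (F u x - F v x) * G v x); last by ring.
rewrite (le_trans (ler_normD _ _))// [leRHS]mulrDl lerD// normrM.
  by rewrite -mulrA ler_pM// GN.
by rewrite mulrAC ler_pM// FN.
Qed.

Lemma lipfam_cst (c : R) : lipfam (fun _ _ => c).
Proof.
exists `|c|, 0; split => // u uI; split => // [|v vI x]; first exact: bm_cst.
by rewrite subrr normr0 mul0r.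
Qed.

Lemma lipfamB F G : lipfam F -> lipfam G -> lipfam (fun u x => F u x - G u x).
Proof.
move=> lF lG; have := lipfamD lF (lipfamM (lipfam_cst (-1)) lG).
by congr lipfam; apply/funext => u; apply/funext => x; rewrite mulN1r.
Qed.

Lemma lipfam_mean F : lipfam F -> lipfam (fun u _ => mean (mu u) (F u)).
Proof.
move=> [M [N [M0 N0 FMN]]]; exists M, (L * (1 + D) * M + N).
split=> //; first by rewrite addr_ge0// !mulr_ge0// addr_ge0.
move=> u uI; have [bF FM FN] := FMN u uI.
split=> [|_|v vI _]; first exact: bm_cst.
  exact: (mean_abs (mu1 u)).
have [bFv FMv _] := FMN v vI.
rewrite (_ : _ - _ = (mean (mu u) (F u) - mean (mu v) (F u)) +
  (mean (mu v) (F u) - mean (mu v) (F v))); last by ring.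
rewrite (le_trans (ler_normD _ _))// mulrDl lerD//; first exact: mean_lip.
by apply: (mean_approx (mu1 v)) => // x; exact: FN.
Qed.

(** The difference p - p' of the solutions at u and v solves a Poisson-type equation for Q_u. Its
    source G collects the change of F, of the kernel and of the mean, one summand of B each. This
    controls p - p' up to its mean under mu_u, which is -mu_u(p'); since mu_v(p') = 0, [mean_lip]
    bounds that too. *)
Lemma lipfam_poisson F : lipfam F -> lipfam (fun u => poisson (k u) (mu u) (F u)).
Proof.
move=> lF; have [M [N [M0 N0 FMN]]] := lF.
have [Mm [Nm [Mm0 Nm0 mF]]] := lipfam_mean lF.
pose B := N + L * (M + D * M) + Nm.
exists (D * M), (D * B + L * (1 + D) * (D * M)); split.
- exact: mulr_ge0.
- have DM0 : 0 <= D * M by exact: mulr_ge0.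
  have B0 : 0 <= B by apply: addr_ge0 => //; apply: addr_ge0 => //; rewrite mulr_ge0// ?addr_ge0.
  apply: addr_ge0; first exact: mulr_ge0.
  apply: mulr_ge0 => //; apply: mulr_ge0 => //; exact: addr_ge0.
move=> u uI; have [bF FM FN] := FMN u uI.
have ergu f M n x := @erg u f M n x uI.
pose p := poisson (k u) (mu u) (F u).
have bp : bm p := bm_poisson q01 C0 ergu bF FM.
have pM x : `|p x| <= D * M := poisson_abs q01 C0 ergu bF FM x.
split => // v vI x.
have [bFv FMv _] := FMN v vI.
have ergv f M n x := @erg v f M n x vI.
pose p' := poisson (k v) (mu v) (F v).
have bpv : bm p' := bm_poisson q01 C0 ergv bFv FMv.
have pMv x : `|p' x| <= D * M := poisson_abs q01 C0 ergv bFv FMv x.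
have pE x : kop (k u) (fun y => F u y + p y) x = p x + mean (mu u) (F u) :=
  poissonE q01 C0 ergu bF FM x.
have pEv x : kop (k v) (fun y => F v y + p' y) x = p' x + mean (mu v) (F v) :=
  poissonE q01 C0 ergv bFv FMv x.
have mp : mean (mu u) p = 0 := mean_poisson q01 C0 (kmu uI) ergu bF FM.
have mpv : mean (mu v) p' = 0 := mean_poisson q01 C0 (kmu vI) ergv bFv FMv.
rewrite -/p -/p'.
have bd := bmB bp bpv.
pose G x := (p x - p' x) - kop (k u) (fun x => p x - p' x) x.
have bG : bm G by apply: bmB => //; exact: bm_kop.
have bh := bmD bFv bpv.
have Gle y : `|G y| <= B * `|u - v|.
  have -> : G y = kop (k u) (fun x => F u x - F v x) y +
      (kop (k u) (fun x => F v x + p' x) y - kop (k v) (fun x => F v x + p' x) y)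
      - (mean (mu u) (F u) - mean (mu v) (F v)).
    have := pE y; have := pEv y.
    rewrite /G (kopB _ _ bp bpv) (kopB _ _ bF bFv) (kopD _ _ bF bp).
    rewrite !(kopD _ _ bFv bpv).
    move: (p y) (p' y) (kop (k u) p y) (kop (k u) p' y) (kop (k u) (F u) y)
      (kop (k u) (F v) y) (kop (k v) (F v) y) (kop (k v) p' y)
      (mean (mu u) (F u)) (mean (mu v) (F v)) => ? ? ? ? ? ? ? ? ? ?; lra.
  rewrite !mulrDl (le_trans (ler_normB _ _))// lerD//; last first.
    by have [_ _] := mF u uI; exact.
  rewrite (le_trans (ler_normD _ _))// lerD//.
    by apply: kop_abs => [|z]; [exact: bmB|exact: FN].
  rewrite -mulrA [_ * `|_|]mulrC mulrA; apply: klip => // z.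
  by rewrite (le_trans (ler_normD _ _))// lerD.
have dG z : p z - p' z = kop (k u) (fun x => p x - p' x) z + G z.
  by rewrite /G; ring.
have := poisson_unique q01 C0 (kmu uI) ergu bd bG dG Gle x.
have := mean_lip uI vI bpv pMv.
rewrite (meanB (mu1 u) bp bpv) mp mpv -/D.
move: (p x) (p' x) (mean (mu u) p') => a b c h1 h2.
rewrite (_ : a - b = (a - b - (0 - c)) - (c - 0)); last by ring.
by rewrite mulrDl (le_trans (ler_normB _ _))// lerD// -mulrA.
Qed.

End family.

(** * The moment generating function *)

Section scalar.
Context (R : realType).
Implicit Types x y l s D N : R.

(** Since (j+3)! >= 2^(j+1), the tail is dominated by a geometric series of ratio 1/2 whose sum is
    exactly |x|^3. *)
Lemma expR_taylor2 x : `|x| <= 1 ->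
  `|expR x - (1 + x + x ^+ 2 / 2)| <= `|x| ^+ 3.
Proof.
move=> x1; have h01 : 0 < (2^-1 : R) < 1 by apply/andP; split; lra.
pose u j := exp_coeff x j.+3.
have uj j : `|u j| <= (`|x| ^+ 3 / 2) * 2^-1 ^+ j.
  have -> : `|u j| = `|x| ^+ 3 * `|x| ^+ j / (j.+3)`!%:R.
    rewrite /u /exp_coeff normrM normrX normfV [`|_%:R|]ger0_norm//.
    by rewrite -exprD.
  rewrite -(mulrA (`|x| ^+ 3)) -(mulrA (`|x| ^+ 3)) ler_wpM2l ?exprn_ge0//.
  rewrite -exprS exprVn -[leRHS]mul1r; apply: ler_pM.
  - exact: exprn_ge0.
  - by rewrite invr_ge0.
  - exact: exprn_ile1.
  rewrite lef_pV2 ?posrE ?exprn_gt0 ?ltr0n ?fact_gt0// -natrX ler_nat.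
  elim: j => // j IH; rewrite expnS factS leq_mul//.
have sN (N : nat) : `|series (exp_coeff x) N.+3 - (1 + x + x ^+ 2 / 2)| <= `|x| ^+ 3.
  have -> : series (exp_coeff x) N.+3 - (1 + x + x ^+ 2 / 2) = \sum_(0 <= j < N) u j.
    rewrite /series/= !big_nat_recl//= /exp_coeff/= expr0 expr1 !divr1.
    by rewrite /u; ring.
  have := geo_sum h01 (_ : 0 <= `|x| ^+ 3 / 2) uj (leq0n N).
  rewrite expr0 mulr1; have -> : `|x| ^+ 3 / 2 / (1 - 2^-1) = `|x| ^+ 3 by field.
  by apply; rewrite divr_ge0// exprn_ge0.
have sN3 (N : nat) : (3 <= N)%N ->
    `|series (exp_coeff x) N - (1 + x + x ^+ 2 / 2)| <= `|x| ^+ 3.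
  by case: N => [|[|[|N]]].
have cx := is_cvg_series_exp_coeff x.
rewrite -[expR x]/(limn (series (exp_coeff x))).
rewrite ler_distl; apply/andP; split.
  apply: limr_ge => //; near=> n; have := sN3 n.
  by rewrite ler_distl => /(_ _)/andP[]//; near: n; exact: nbhs_infty_ge.
apply: limr_le => //; near=> n; have := sN3 n.
by rewrite ler_distl => /(_ _)/andP[]//; near: n; exact: nbhs_infty_ge.
Unshelve. all: end_near. Qed.

(** From e^z >= 1 + z at z = 2 y^2 - y, and (1 - y + 2 y^2)(1 + y) = 1 + y^2 (1 + 2 y) >= 1. *)
Lemma expR_le1Dx y : - 2^-1 <= y -> expR (y - 2 * y ^+ 2) <= 1 + y.
Proof.
move=> y2; have := expR_ge1Dx (2 * y ^+ 2 - y); rewrite -opprB expRN.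
have e0 := expR_gt0 (y - 2 * y ^+ 2).
move: (expR _) e0 => e e0 h.
have {}h : (1 - (y - 2 * y ^+ 2)) * e <= 1.
  by rewrite -ler_pdivlMr// div1r.
have c0 : 0 < 1 - (y - 2 * y ^+ 2).
  have : 0 <= (y - 2^-1) ^+ 2 by exact: sqr_ge0.
  nra.
rewrite -(ler_pM2l c0) (le_trans h)//.
have : 0 <= y ^+ 2 * (1 + 2 * y) by rewrite mulr_ge0 ?sqr_ge0//; lra.
nra.
Qed.

(** Beyond order two there remain the Taylor remainder times the second factor, which is at most 2,
    and an explicit multiple of l^3. Each contributes 2 D^3 |l|^3; [1 <= D] lets D^3 dominate the
    lower powers. *)
Lemma step_remainder l D f p w : 1 <= D -> `|l| * D <= 4^-1 ->
  `|f| <= D -> `|p| <= D -> `|w| <= D ->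
  `|expR (l * f) * (1 + l * p + l ^+ 2 * w) -
    (1 + l * (f + p) + l ^+ 2 * (f ^+ 2 / 2 + f * p + w))| <= 4 * D ^+ 3 * `|l| ^+ 3.
Proof.
move=> D1 lD fD pD wD.
have D0 : 0 <= D by lra.
have l4 : `|l| <= 4^-1 by rewrite (le_trans _ lD)// ler_peMr.
have lf (z : R) : `|z| <= D -> `|l * z| <= 4^-1.
  by move=> zD; rewrite normrM (le_trans _ lD)// ler_wpM2l.
have lfD : `|l * f| ^+ 3 <= D ^+ 3 * `|l| ^+ 3.
  rewrite normrM exprMn mulrC ler_wpM2r ?exprn_ge0//.
  by rewrite lerXn2r ?nnegrE.
have U2 : `|1 + l * p + l ^+ 2 * w| <= 2.
  have := lf _ pD; have := lf _ wD; have := l4.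
  rewrite expr2 -mulrA; move: (l * p) (l * w) => a b l1 b1 a1.
  have : `|l * b| <= 4^-1 * 4^-1 by rewrite normrM ler_pM.
  by move: a1; rewrite !ler_norml; lra.
have := @expR_taylor2 (l * f) (le_trans (lf _ fD) _); rewrite (_ : (4^-1 <= 1) = true); last by lra.
move=> /(_ isT) E.
rewrite (_ : _ - _ = (expR (l * f) - (1 + l * f + (l * f) ^+ 2 / 2)) *
  (1 + l * p + l ^+ 2 * w) + l ^+ 3 * (f * w + f ^+ 2 * p / 2 + l * w * f ^+ 2 / 2)); last by field.
rewrite (le_trans (ler_normD _ _))// normrM [leRHS](_ : _ =
  D ^+ 3 * `|l| ^+ 3 * 2 + `|l| ^+ 3 * (2 * D ^+ 3)); last by ring.
rewrite lerD//.
  by rewrite ler_pM// (le_trans E).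
rewrite normrM normrX ler_wpM2l ?exprn_ge0//.
have D23 : D ^+ 2 <= D ^+ 3 by apply: ler_weXn2l.
have fw : `|f * w| <= D ^+ 2 by rewrite normrM expr2 ler_pM.
have ff : `|f ^+ 2| <= D ^+ 2 by rewrite normrX lerXn2r ?nnegrE.
have ffp : `|f ^+ 2 * p| <= D ^+ 3 by rewrite normrM [leRHS]exprSr ler_pM.
have lff : `|l * w * f ^+ 2| <= 4^-1 * D ^+ 2.
  rewrite normrM; apply: ler_pM => //. exact: lf.
have D20 : 0 <= D ^+ 2 by rewrite exprn_ge0.
move: fw ffp lff D23 D20; rewrite !ler_norml.
move: (D ^+ 2) (D ^+ 3) (f * w) (f ^+ 2 * p) (l * w * f ^+ 2) => ? ? ? ? ?.
lra.
Qed.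

(** Here v is the eigenfunction at the new time, v' at the old one and e the time step. As v' >=
    1/2, an additive error h is at most 2 h v', so y lies between (1 + l^2 s - 2 h) v' and (1 + l^2
    s + 2 h) v'; then e^(z - 2 z^2) <= 1 + z <= e^z moves everything into the exponent. *)
Lemma step_growth l s D N y v v' e eps : 1 <= D -> 0 <= N -> `|l| * (D + N) <= 64^-1 ->
  0 <= e <= 1 ->
  `|s| <= D -> `|y - (1 + l ^+ 2 * s) * v| <= 6 * D ^+ 3 * `|l| ^+ 3 ->
  `|v - v'| <= 2 * N * (`|l| * e) -> 2^-1 <= v' ->
  eps = (32 * D ^+ 3 + 32 * N) * (`|l| ^+ 3 + `|l| * e) ->
  expR (l ^+ 2 * s - eps) * v' <= y <= expR (l ^+ 2 * s + eps) * v'.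
Proof.
move=> D1 N0 lDN /andP[e0 e1] sD yv vv v2 epsE.
have L0 : 0 <= `|l| by [].
have D0 : 0 <= D by lra.
have lD : `|l| * D <= 64^-1.
  by rewrite (le_trans _ lDN)// ler_wpM2l// lerDl.
have lN : `|l| * N <= 64^-1.
  by rewrite (le_trans _ lDN)// ler_wpM2l// lerDr.
have l1 : `|l| <= 64^-1 by rewrite (le_trans _ lD)// ler_peMr.
have lsn : `|l ^+ 2 * s| <= `|l| * (`|l| * D).
  by rewrite normrM normrX expr2 -mulrA ler_wpM2l// ler_wpM2l.
pose w := l ^+ 2 * s; rewrite -/w in yv lsn *.
have w1 : `|w| <= 64^-1 * 64^-1 by rewrite (le_trans lsn)// ler_pM// mulr_ge0.
pose A := D ^+ 3 * `|l| ^+ 3; pose B := N * (`|l| * e).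
rewrite -(mulrA 6) -/A in yv; rewrite -(mulrA 2) -/B in vv.
(* 6 A is the error of the eigenvalue equation; 4 B is the change from v to v', at most 2 B, times
   |1 + w| <= 2. *)
pose h := 6 * A + 4 * B.
have A0 : 0 <= A by rewrite mulr_ge0// exprn_ge0.
have A1 : A <= 64^-1.
  rewrite /A -exprMn mulrC (le_trans _ lD)// exprS ler_piMr ?mulr_ge0//.
  by rewrite exprn_ile1// ?mulr_ge0// (le_trans lD)//; lra.
have B0 : 0 <= B by rewrite !mulr_ge0.
have B1 : B <= 64^-1.
  by rewrite /B mulrA (le_trans _ lN)// [N * _]mulrC ler_piMr// mulr_ge0.
have h0 : 0 <= h by rewrite /h; lra.
have h1 : h <= 6^-1 by rewrite /h; lra.
have yh : `|y - (1 + w) * v'| <= h.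
  rewrite (_ : y - _ = (y - (1 + w) * v) + (1 + w) * (v - v')); last by ring.
  rewrite (le_trans (ler_normD _ _))// lerD// normrM.
  have w2 : `|1 + w| <= 2 by move: w1; rewrite !ler_norml; lra.
  by rewrite (le_trans (ler_pM _ _ w2 vv))//; lra.
have hv : h <= 2 * h * v' by nra.
have E3 : 32 * A + 32 * B <= eps.
  rewrite epsE /A /B; have : 0 <= D ^+ 3 by rewrite exprn_ge0.
  have : 0 <= `|l| ^+ 3 by rewrite exprn_ge0.
  have : 0 <= `|l| * e by rewrite mulr_ge0.
  move: (D ^+ 3) (`|l| ^+ 3) (`|l| * e) => a b c ? ? ?; nra.
(* w^2 is of order l^4, so the cubic error absorbs it. *)
have wD : w ^+ 2 <= 64^-1 * A.
  have -> : w ^+ 2 = `|w| * `|w| by rewrite -normrM -expr2 ger0_norm// sqr_ge0.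
  rewrite (le_trans (ler_pM _ _ lsn lsn))//.
  rewrite [leLHS](_ : _ = (`|l| * D) * (D * `|l| ^+ 3)); last by ring.
  rewrite ler_pM ?mulr_ge0 ?exprn_ge0// ler_wpM2r ?exprn_ge0//.
  by rewrite exprS ler_peMr// exprn_ege1.
have hE : 2 * h + 2 * (w - 2 * h) ^+ 2 <= eps.
  apply: le_trans E3.
  have hh : h ^+ 2 <= 6^-1 * h by rewrite expr2 ler_wpM2r.
  have : 2 * (w - 2 * h) ^+ 2 <= 4 * w ^+ 2 + 16 * h ^+ 2.
    have : 0 <= (w + 2 * h) ^+ 2 by exact: sqr_ge0.
    nra.
  move: hh wD; move: (w ^+ 2) (h ^+ 2) ((w - 2 * h) ^+ 2) => a b c.
  rewrite /h; lra.
have yh' := yh; move: yh'; rewrite ler_norml => /andP[y1 y2].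
apply/andP; split.
  apply: (@le_trans _ _ ((1 + (w - 2 * h)) * v')); last by nra.
  rewrite ler_wpM2r//; first by lra.
  apply: le_trans (expR_le1Dx _); last by move: w1; rewrite ler_norml; lra.
  by rewrite ler_expR; lra.
apply: (@le_trans _ _ ((1 + (w + 2 * h)) * v')); first by nra.
rewrite ler_wpM2r//; first by lra.
apply: le_trans (expR_ge1Dx _) _; rewrite ler_expR.
have : 0 <= 2 * (w - 2 * h) ^+ 2 by rewrite mulr_ge0// sqr_ge0.
move: ((w - 2 * h) ^+ 2) hE => ? ? ?; lra.
Qed.

End scalar.

(** * The approximate eigenfunction *)

Section moment_generating_function.
Context d (T : measurableType d) (R : realType).
Variables (k : R -> R.-pker T ~> T) (mu : R -> probability T R) (C q L : R).
Hypotheses (q01 : 0 < q < 1) (C0 : 0 <= C) (L0 : 0 <= L).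
Hypothesis kmu : forall u : R, u \in `[0, 1] -> invariant_measure (k u) (mu u).
Hypothesis erg : forall (u : R) (f : T -> R) (M : R) n x, u \in `[0, 1] ->
  bm f -> (forall x, `|f x| <= M) ->
  `|iter n (kop (k u)) f x - mean (mu u) f| <= C * q ^+ n * M.
Hypothesis klip : forall (u v : R) (f : T -> R) (M : R) x,
  u \in `[0, 1] -> v \in `[0, 1] -> bm f -> (forall x, `|f x| <= M) ->
  `|kop (k u) f x - kop (k v) f x| <= L * `|u - v| * M.
Variable g : R -> T -> R.
Hypothesis lipg : lipfam g.

Let mu1 u : (mu u setT <= 1)%E. Proof. by rewrite probability_setT. Qed.

Definition centered u x := g u x - mean (mu u) (g u).
Definition corrector u := poisson (k u) (mu u) (g u).
(* Green-Kubo: twice its mean is the asymptotic variance of g u under Q u. *)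
Definition energy u x :=
  centered u x ^+ 2 / 2 + centered u x * corrector u x.
Definition half_variance u := mean (mu u) (energy u).
Definition corrector2 u := poisson (k u) (mu u) (energy u).

Lemma lipfam_centered : lipfam centered.
Proof. by apply: lipfamB => //; exact: (lipfam_mean q01 C0 L0 kmu erg klip). Qed.

Lemma lipfam_corrector : lipfam corrector.
Proof. exact: (lipfam_poisson q01 C0 L0 kmu erg klip). Qed.

Lemma lipfam_energy : lipfam energy.
Proof.
have lc := lipfam_centered; have lp := lipfam_corrector.
have := lipfamD (lipfamM (lipfamM lc lc) (lipfam_cst _ 2^-1)) (lipfamM lc lp).
by congr lipfam; apply/funext => u; apply/funext => x; rewrite /energy expr2.
Qed.

Lemma lipfam_half_variance : lipfam (fun u (_ : T) => half_variance u).
Proof. exact: (lipfam_mean q01 C0 L0 kmu erg klip lipfam_energy). Qed.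

Lemma lipfam_corrector2 : lipfam corrector2.
Proof. exact: (lipfam_poisson q01 C0 L0 kmu erg klip lipfam_energy). Qed.

Lemma kop_corrector u x : u \in `[0, 1] ->
  kop (k u) (fun y => centered u y + corrector u y) x = corrector u x.
Proof.
move=> uI; have [M [N [_ _ /(_ u uI)[bg gM _]]]] := lipg.
have ergu f M n x := @erg u f M n x uI.
have bp := bm_poisson q01 C0 ergu bg gM.
have := poissonE q01 C0 ergu bg gM x; rewrite -/(corrector u x).
rewrite (_ : (fun y => centered u y + corrector u y) = fun y =>
  (g u y + poisson (k u) (mu u) (g u) y) - mean (mu u) (g u)).
  move=> E; rewrite kopB; [|exact: bmD|exact: bm_cst].
  by rewrite E kop_cst addrK.
by apply/funext => y; rewrite /centered /corrector addrAC.
Qed.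

Lemma kop_corrector2 u x : u \in `[0, 1] ->
  kop (k u) (fun y => energy u y + corrector2 u y) x =
  corrector2 u x + half_variance u.
Proof.
move=> uI; have [M [N [_ _ /(_ u uI)[bg gM _]]]] := lipfam_energy.
have ergu f M n x := @erg u f M n x uI.
exact: (poissonE q01 C0 ergu bg gM x).
Qed.

(** One pair of constants for all u, fixed before n and l are chosen. *)
Definition bound_all (D N : R) := [/\ 1 <= D, 0 <= N & forall u : R, u \in `[0, 1] ->
  [/\ forall x, `|centered u x| <= D, forall x, `|corrector u x| <= D,
   forall x, `|corrector2 u x| <= D, `|half_variance u| <= D &
   forall v : R, v \in `[0, 1] -> [/\
     forall x, `|corrector u x - corrector v x| <= N * `|u - v|,
     forall x, `|corrector2 u x - corrector2 v x| <= N * `|u - v| &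
     `|half_variance u - half_variance v| <= N * `|u - v| ]]].

Lemma bound_all_ex : exists D N, bound_all D N.
Proof.
have [M1 [N1 [M10 N10 H1]]] := lipfam_centered.
have [M2 [N2 [M20 N20 H2]]] := lipfam_corrector.
have [M3 [N3 [M30 N30 H3]]] := lipfam_corrector2.
have [M4 [N4 [M40 N40 H4]]] := lipfam_half_variance.
have [D1 [D2 [D3 D4]]] : let D := 1 + M1 + M2 + M3 + M4 in
    M1 <= D /\ M2 <= D /\ M3 <= D /\ M4 <= D by rewrite /=; lra.
have [E2 [E3 E4]] : let N := N2 + N3 + N4 in N2 <= N /\ N3 <= N /\ N4 <= N.
  by rewrite /=; lra.
exists (1 + M1 + M2 + M3 + M4), (N2 + N3 + N4); split; [lra|lra|move=> u uI].
have [b1 c1 d1] := H1 u uI; have [b2 c2 d2] := H2 u uI.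
have [b3 c3 d3] := H3 u uI; have [b4 c4 d4] := H4 u uI.
split.
- by move=> x; exact: le_trans (c1 x) _.
- by move=> x; exact: le_trans (c2 x) _.
- by move=> x; exact: le_trans (c3 x) _.
- exact: le_trans (c4 point) _.
- move=> v vI; split => [x|x|].
  + by rewrite (le_trans (d2 v vI x))// ler_wpM2r.
  + by rewrite (le_trans (d3 v vI x))// ler_wpM2r.
  + by rewrite (le_trans (d4 v vI point))// ler_wpM2r.
Qed.

Let bc u : u \in `[0, 1] -> bm (centered u).
Proof. by move=> uI; have [M [N [_ _ /(_ u uI)[]]]] := lipfam_centered. Qed.
Let bp u : u \in `[0, 1] -> bm (corrector u).
Proof. by move=> uI; have [M [N [_ _ /(_ u uI)[]]]] := lipfam_corrector. Qed.
Let be u : u \in `[0, 1] -> bm (energy u).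
Proof. by move=> uI; have [M [N [_ _ /(_ u uI)[]]]] := lipfam_energy. Qed.
Let bw u : u \in `[0, 1] -> bm (corrector2 u).
Proof. by move=> uI; have [M [N [_ _ /(_ u uI)[]]]] := lipfam_corrector2. Qed.

(* An eigenfunction of f |-> Q_u (e^(l g_u) f), up to O(l^3); the eigenvalue is
   1 + l^2 half_variance u. *)
Definition perturbed (l u : R) x := 1 + l * corrector u x + l ^+ 2 * corrector2 u x.

Lemma bm_perturbed l u : u \in `[0, 1] -> bm (perturbed l u).
Proof.
move=> uI; apply: bmD; last by apply: bmZ; exact: bw.
by apply: bmD; [exact: bm_cst|apply: bmZ; exact: bp].
Qed.

Variables (D N : R).
Hypothesis DN : bound_all D N.

Lemma perturbed_bound l u x : u \in `[0, 1] -> `|l| * (D + N) <= 64^-1 ->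
  2^-1 <= perturbed l u x <= 2.
Proof.
move=> uI lDN; have [D1 N0 /(_ u uI)[cD pD wD sD _]] := DN.
have D0 : 0 <= D by lra.
have lD : `|l| * D <= 64^-1.
  by rewrite (le_trans _ lDN)// ler_wpM2l// lerDl.
have l1 : `|l| <= 1 by rewrite (@le_trans _ _ 64^-1)//; [rewrite (le_trans _ lD)// ler_peMr|lra].
have h1 : `|l * corrector u x| <= 64^-1.
  by rewrite normrM (le_trans _ lD)// ler_wpM2l.
have h2 : `|l ^+ 2 * corrector2 u x| <= 64^-1.
  rewrite expr2 -mulrA normrM (le_trans _ lD)// -[leRHS]mul1r ler_pM//.
  by rewrite normrM ler_wpM2l.
rewrite /perturbed; move: h1 h2; rewrite !ler_norml.
by move: (l * _) (l ^+ 2 * _) => ? ?; lra.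
Qed.

Lemma perturbed_lip l u v x : u \in `[0, 1] -> v \in `[0, 1] -> `|l| <= 1 ->
  `|perturbed l u x - perturbed l v x| <= 2 * N * (`|l| * `|u - v|).
Proof.
move=> uI vI l1; have [D1 N0 /(_ u uI)[_ _ _ _ /(_ v vI)[pN wN _]]] := DN.
rewrite (_ : _ - _ = l * (corrector u x - corrector v x) +
  l * (l * (corrector2 u x - corrector2 v x))); last first.
  rewrite /perturbed.
  by move: (corrector u x) (corrector v x) (corrector2 u x) (corrector2 v x) => ? ? ? ?; ring.
rewrite (le_trans (ler_normD _ _))// [leRHS](_ : _ =
  `|l| * (N * `|u - v|) + `|l| * (1 * (N * `|u - v|))); last by ring.
rewrite !normrM lerD// ler_wpM2l//.
by rewrite ler_pM.
Qed.

(** On the second-order expansion A the two Poisson equations give the operator exactly. What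
    remains is the pointwise remainder, 4 D^3 |l|^3, and the l^3 terms of the product of eigenvalue
    and eigenfunction, 2 D^3 |l|^3. *)
Lemma kop_perturbed l u x : u \in `[0, 1] -> `|l| * (D + N) <= 64^-1 ->
  `|kop (k u) (fun y => expR (l * centered u y) * perturbed l u y) x -
    (1 + l ^+ 2 * half_variance u) * perturbed l u x| <= 6 * D ^+ 3 * `|l| ^+ 3.
Proof.
move=> uI lDN; have [D1 N0 /(_ u uI)[cD pD wD sD _]] := DN.
have D0 : 0 <= D by lra.
have lD : `|l| * D <= 4^-1.
  by rewrite (@le_trans _ _ 64^-1)//; [rewrite (le_trans _ lDN)// ler_wpM2l// lerDl|lra].
have l1 : `|l| <= 1 by rewrite (@le_trans _ _ 4^-1)//; [rewrite (le_trans _ lD)// ler_peMr|lra].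
have bcu := bc uI; have bpu := bp uI; have beu := be uI; have bwu := bw uI.
have bcp := bmD bcu bpu; have bew := bmD beu bwu.
pose A y := 1 + l * (centered u y + corrector u y) +
  l ^+ 2 * (energy u y + corrector2 u y).
have b1 : bm (fun y => 1 + l * (centered u y + corrector u y)).
  by apply: bmD; [exact: bm_cst|exact: bmZ].
have bA : bm A by apply: bmD => //; exact: bmZ.
have bE : bm (fun y => expR (l * centered u y) * perturbed l u y).
  by apply: bmM; [apply: bm_expR; exact: bmZ|exact: bm_perturbed].
have kA : kop (k u) A x = 1 + l * corrector u x + l ^+ 2 * (corrector2 u x + half_variance u).
  rewrite /A (kopD _ _ b1 (bmZ _ bew)) (kopD _ _ (bm_cst _ _) (bmZ _ bcp)).
  by rewrite kop_cst !kopZ// kop_corrector// kop_corrector2.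
have EA : `|kop (k u) (fun y => expR (l * centered u y) * perturbed l u y) x -
    kop (k u) A x| <= 4 * D ^+ 3 * `|l| ^+ 3.
  rewrite -kopB//; apply: kop_abs => [|y]; first exact: bmB.
  exact: step_remainder.
rewrite (_ : _ - _ = (kop (k u) (fun y => expR (l * centered u y) * perturbed l u y) x -
    kop (k u) A x) - l ^+ 3 * (half_variance u * (corrector u x + l * corrector2 u x)));
  last first.
  rewrite kA /perturbed; move: (kop _ _ _) (corrector u x) (corrector2 u x) => ? ? ?.
  by move: (half_variance u) => ?; ring.
rewrite (le_trans (ler_normB _ _))// [leRHS](_ : _ =
  4 * D ^+ 3 * `|l| ^+ 3 + `|l| ^+ 3 * (D * (D + 1 * D) * D)); last by ring.
rewrite lerD// normrM normrX ler_wpM2l ?exprn_ge0//.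
apply: (@le_trans _ _ (D * (D + 1 * D))); last first.
  by rewrite ler_peMr// mulr_ge0// addr_ge0// mul1r.
rewrite normrM ler_pM// (le_trans (ler_normD _ _))// lerD// normrM ler_pM//.
Qed.

(** * Iteration along the chain *)

Section chain.
Context dO (Omega : measurableType dO) (P : probability Omega R).
Variables (X : nat -> {RV P >-> T}) (nu : probability T R) (n : nat).
Hypothesis n0 : (0 < n)%N.
Hypothesis XQ : markov_chain (fun j => k (j%:R / n%:R)) nu n X.
Variable l : R.
Hypothesis lDN : `|l| * (D + N) <= 64^-1.

Let P1 : (P setT <= 1)%E. Proof. by rewrite probability_setT. Qed.

Let t (j : nat) : R := j%:R / n%:R.

Let tI j : (j <= n)%N -> t j \in `[0, 1].
Proof.
move=> jn; rewrite in_itv/= divr_ge0//= ler_pdivrMr ?ltr0n// mul1r.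
by rewrite ler_nat.
Qed.

Definition centered_sum j w := \sum_(1 <= i < j.+1) centered (t i) (X i w).

Lemma past_centered_sum j : (j <= n)%N -> past_bm X j.+1 (centered_sum j).
Proof.
move=> jn; apply: bm_sum => i; rewrite mem_index_iota => /andP[_ ij].
by apply: past_rv => //; apply: bc; apply: tI; rewrite (leq_trans _ jn).
Qed.

Let E j := mean P (fun w => expR (l * centered_sum j w) * perturbed l (t j) (X j w)).

Let eps := (32 * D ^+ 3 + 32 * N) * (`|l| ^+ 3 + `|l| * n%:R^-1).

Let past_exp j : (j <= n)%N -> past_bm X j.+1 (fun w => expR (l * centered_sum j w)).
Proof. by move=> jn; apply: bm_expR; apply: bmZ; exact: past_centered_sum. Qed.

(** Conditioning on the past up to j leaves the operator at t_(j+1) applied to the eigenfunction of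
    the same time, evaluated at X_j. The result is compared with the eigenfunction at t_j, the one
    occurring in [E j]. *)
Let E_step j : (j < n)%N ->
  expR (l ^+ 2 * half_variance (t j.+1) - eps) * E j <= E j.+1 <=
  expR (l ^+ 2 * half_variance (t j.+1) + eps) * E j.
Proof.
move=> jn; have [D1 N0 HDN] := DN.
have jI := tI (ltnW jn); have j1I := tI jn.
have [cD pD wD sD _] := HDN _ j1I.
have D0 : 0 <= D by lra.
have l1 : `|l| <= 1.
  rewrite (@le_trans _ _ 64^-1)//; last by lra.
  by rewrite (le_trans _ lDN)// ler_peMr//; lra.
have n1 : 0 <= (n%:R^-1 : R) <= 1.
  by rewrite invr_ge0 ler0n/= invf_le1 ?ltr0n// ler1n.
have tt : `|t j.+1 - t j| = n%:R^-1.
  by rewrite /t -mulrBl -natrB// subSnn mul1r ger0_norm// invr_ge0.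
have pe := past_exp (ltnW jn).
have bpe : bm (fun w => expR (l * centered_sum j w)) := past_bm_bm pe.
have bp1 : bm (perturbed l (t j.+1)) := bm_perturbed l j1I.
have bp0 : bm (perturbed l (t j)) := bm_perturbed l jI.
have bG : bm (fun y => expR (l * centered (t j.+1) y) * perturbed l (t j.+1) y).
  by apply: bmM => //; apply: bm_expR; apply: bmZ; exact: bc.
have EE : E j.+1 = mean P (fun w => expR (l * centered_sum j w) *
    kop (k (t j.+1)) (fun y => expR (l * centered (t j.+1) y) * perturbed l (t j.+1) y) (X j w)).
  rewrite -[RHS](cond_mean XQ (k := j.+1))//.
  congr mean; apply/funext => w.
  have -> : centered_sum j.+1 w = centered_sum j w + centered (t j.+1) (X j.+1 w).
    by rewrite /centered_sum big_nat_recr.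
  by rewrite (mulrDr l) expRD mulrA.
have br h : bm h -> bm (fun w => expR (l * centered_sum j w) * h (X j w)).
  by move=> bh; apply: bmM => //; exact: (bm_rv X j bh).
have bk := bm_kop (k (t j.+1)) bG.
have H x : expR (l ^+ 2 * half_variance (t j.+1) - eps) * perturbed l (t j) x <=
   kop (k (t j.+1)) (fun y => expR (l * centered (t j.+1) y) * perturbed l (t j.+1) y) x <=
   expR (l ^+ 2 * half_variance (t j.+1) + eps) * perturbed l (t j) x.
  apply: (step_growth D1 N0 lDN n1 sD (kop_perturbed x j1I lDN)) => //.
    by rewrite -tt; exact: perturbed_lip.
  by case/andP: (perturbed_bound x jI lDN).
have Z c : c * E j = mean P (fun w => c * (expR (l * centered_sum j w) *
    perturbed l (t j) (X j w))) by rewrite (meanZ P1 c (br _ bp0)).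
rewrite EE !Z; apply/andP; split.
  apply: mean_le => //; [apply: bmZ; exact: br|exact: br|move=> w].
  by rewrite mulrCA ler_wpM2l ?expR_ge0//; case/andP: (H (X j w)).
apply: mean_le => //; [exact: br|apply: bmZ; exact: br|move=> w].
by rewrite [leRHS]mulrCA ler_wpM2l ?expR_ge0//; case/andP: (H (X j w)).
Qed.

Let E0 : 2^-1 <= E 0 <= 2.
Proof.
have H w : 2^-1 <= expR (l * centered_sum 0 w) * perturbed l (t 0) (X 0%N w) <= 2.
  by rewrite /centered_sum big_geq// mulr0 expR0 mul1r perturbed_bound// tI.
have b : bm (fun w => expR (l * centered_sum 0 w) * perturbed l (t 0) (X 0%N w)).
  apply: bmM; first exact: (past_bm_bm (past_exp (leq0n n))).
  exact: (bm_rv X 0 (bm_perturbed l (tI (leq0n n)))).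
have P1' : P setT = 1%E by rewrite probability_setT.
apply/andP; split.
  rewrite -(mean_cst (2^-1 : R) P1'); apply: mean_le => // [|w]; first exact: bm_cst.
  by case/andP: (H w).
rewrite -[leRHS](mean_cst _ P1'); apply: mean_le => // [|w]; first exact: bm_cst.
by case/andP: (H w).
Qed.

Let E_bound j : (j <= n)%N ->
  expR (l ^+ 2 * (\sum_(1 <= i < j.+1) half_variance (t i)) - j%:R * eps) / 2 <= E j <=
  expR (l ^+ 2 * (\sum_(1 <= i < j.+1) half_variance (t i)) + j%:R * eps) * 2.
Proof.
elim: j => [|j IH] jn.
  by rewrite big_geq// mulr0 mul0r subr0 addr0 expR0 !mul1r.
have /andP[a1 a2] := IH (ltnW jn); have /andP[b1 b2] := E_step jn.
rewrite big_nat_recr//=.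
move: (\sum_(1 <= i < j.+1) _) (half_variance _) a1 a2 b1 b2 => S s a1 a2 b1 b2.
apply/andP; split.
  apply: le_trans b1; rewrite [X in expR X](_ : _ = (l ^+ 2 * s - eps) +
    (l ^+ 2 * S - j%:R * eps)); last by rewrite -natr1; ring.
  by rewrite expRD -mulrA ler_wpM2l ?expR_ge0.
apply: (le_trans b2); rewrite [X in _ <= expR X * _](_ : _ = (l ^+ 2 * s + eps) +
  (l ^+ 2 * S + j%:R * eps)); last by rewrite -natr1; ring.
by rewrite [in leRHS]expRD -mulrA ler_wpM2l ?expR_ge0.
Qed.

(** The eigenfunction lies between 1/2 and 2; using this once at time 0 and once to remove it at
    time n gives the factor 4 on either side. *)
Lemma mgf_bound K S M :
  K = 32 * D ^+ 3 + 32 * N ->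
  S = \sum_(1 <= i < n.+1) half_variance (i%:R / n%:R) ->
  M = mean P (fun w => expR (l * \sum_(1 <= i < n.+1)
                centered (i%:R / n%:R) (X i w))) ->
  expR (l ^+ 2 * S - K * (n%:R * `|l| ^+ 3 + `|l|)) / 4 <= M <=
  expR (l ^+ 2 * S + K * (n%:R * `|l| ^+ 3 + `|l|)) * 4.
Proof.
move=> KE SE ME; have /andP[h1 h2] := E_bound (leqnn n).
have -> : K * (n%:R * `|l| ^+ 3 + `|l|) = n%:R * eps.
  by rewrite /eps KE; field; rewrite pnatr_eq0 -lt0n.
have bW : bm (fun w => expR (l * centered_sum n w)) := past_bm_bm (past_exp (leqnn n)).
have bU : bm (fun w => perturbed l (t n) (X n w)).
  exact: (bm_rv X n (bm_perturbed l (tI (leqnn n)))).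
have U w := perturbed_bound (X n w) (tI (leqnn n)) lDN.
have EM1 : E n <= 2 * M.
  rewrite ME -(meanZ P1 2 bW); apply: mean_le => //; [exact: bmM|exact: bmZ|move=> w].
  by rewrite mulrC ler_wpM2r ?expR_ge0//; case/andP: (U w).
have EM2 : 2^-1 * M <= E n.
  rewrite ME -(meanZ P1 2^-1 bW); apply: mean_le => //; [exact: bmZ|exact: bmM|move=> w].
  by rewrite [leRHS]mulrC ler_wpM2r ?expR_ge0//; case/andP: (U w).
move: h1 h2 EM1 EM2; rewrite -[\sum_(_ <= _ < _) _]SE; move: (E n) (expR _) (expR _) => a b c.
by move=> *; apply/andP; split; lra.
Qed.

End chain.
End moment_generating_function.

(** * Asymptotic variance and Riemann sums *)

Section stationary_variance.
Context d (T : measurableType d) (R : realType).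
Variables (k : R.-pker T ~> T) (mu : probability T R) (C q : R).
Hypotheses (q01 : 0 < q < 1) (C0 : 0 <= C) (kmu : invariant_measure k mu).
Hypothesis erg : forall (f : T -> R) (M : R) n x, bm f -> (forall x, `|f x| <= M) ->
  `|iter n (kop k) f x - mean mu f| <= C * q ^+ n * M.
Variables (g : T -> R) (M : R).
Hypotheses (bg : bm g) (gM : forall x, `|g x| <= M).
Context dO (Omega : measurableType dO) (P : probability Omega R).
Variable Y : nat -> {RV P >-> T}.
Hypothesis Yst : stationary_chain k mu Y.

Let mu1 : (mu setT <= 1)%E. Proof. by rewrite probability_setT. Qed.
Let P1 : (P setT <= 1)%E. Proof. by rewrite probability_setT. Qed.
Let M0 : 0 <= M. Proof. exact: le_trans (gM point). Qed.

Let f x := g x - mean mu g.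
Let bf : bm f. Proof. exact: bmB bg (bm_cst _ _). Qed.
Let phi := poisson k mu g.
Let bphi : bm phi. Proof. exact: (bm_poisson q01 C0 erg bg gM). Qed.

Let fM x : `|f x| <= M + M.
Proof. by rewrite (le_trans (ler_normB _ _))// lerD//; exact: mean_abs. Qed.

Let in1 n : (1 <= n.+1 <= n.+1)%N. Proof. exact: leqnn. Qed.

Lemma mean_stationary n F : bm F -> mean P (fun w => F (Y n w)) = mean mu F.
Proof.
elim: n F => [|n IH] F bF; first exact: (mean_init (Yst.2 0%N) bF).
have b1 : past_bm Y n.+1 (fun=> 1) by exact: bm_cst.
have := cond_mean (Yst.2 n.+1) (in1 n) b1 bF.
under [X in mean _ X = _ -> _]funext do rewrite mul1r.
under [X in _ = mean _ X -> _]funext do rewrite mul1r.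
by move=> ->; rewrite IH ?mean_invariant//; exact: bm_kop.
Qed.

Let S n w := \sum_(1 <= j < n.+1) f (Y j w).

Let SS n w : S n.+1 w = S n w + f (Y n.+1 w).
Proof. by rewrite /S big_nat_recr. Qed.

Let pS n : past_bm Y n.+1 (S n).
Proof.
apply: bm_sum => i; rewrite mem_index_iota => /andP[_ ij].
exact: past_rv.
Qed.

Let bS n : bm (S n). Proof. exact: past_bm_bm (pS n). Qed.

(** Peeling off the last step: the newest summand of S gives the term j = 0, and conditioning the
    older ones replaces F by Q F. *)
Let mean_SF n F : bm F ->
  mean P (fun w => S n w * F (Y n w)) =
  \sum_(0 <= j < n) mean mu (fun x => f x * iter j (kop k) F x).
Proof.
elim: n F => [|n IH] F bF.
  rewrite big_geq// (_ : (fun w => _) = fun=> 0) ?mean0//.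
  by apply/funext => w; rewrite /S big_geq// mul0r.
have bFn := bm_rv Y n.+1 bF.
rewrite (_ : (fun w => _) = fun w => S n w * F (Y n.+1 w) +
  (f (Y n.+1 w) * F (Y n.+1 w))); last first.
  by apply/funext => w; rewrite SS mulrDl.
rewrite (meanD P1 (bmM (bS n) bFn) (bmM (bm_rv Y n.+1 bf) bFn)).
rewrite (mean_stationary n.+1 (bmM bf bF)).
rewrite (cond_mean (Yst.2 n.+1) (in1 n) (pS n) bF)/= (IH _ (bm_kop k bF)).
rewrite big_nat_recl// addrC; congr (_ + _).
by apply: eq_bigr => j _; congr mean; apply/funext => x; rewrite -iterSr.
Qed.

Let sigma2 := mean mu (fun x => f x * f x) + 2 * mean mu (fun x => f x * phi x).

(** The increment of the second moment of S is the Green-Kubo series cut after j terms, hence within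
    a geometric error of its limit; the errors sum to a bound free of n. *)
Let S2 n : `|mean P (fun w => S n w * S n w) - n%:R * sigma2| <=
  2 * ((M + M) * (C / (1 - q) * M)) / (1 - q).
Proof.
pose B := (M + M) * (C / (1 - q) * M).
have B0 : 0 <= B.
  case/andP: q01 => _ q1.
  by rewrite mulr_ge0 ?addr_ge0// mulr_ge0// divr_ge0// subr_ge0 ltW.
have step j : `|mean P (fun w => S j.+1 w * S j.+1 w) -
    mean P (fun w => S j w * S j w) - sigma2| <= 2 * B * q ^+ j.
  have bj := bm_rv Y j.+1 bf.
  rewrite (_ : (fun w => S j.+1 w * S j.+1 w) = fun w => S j w * S j w +
    (2 * (S j w * f (Y j.+1 w)) + f (Y j.+1 w) * f (Y j.+1 w))); last first.
    by apply/funext => w; rewrite SS; move: (S j w) (f _) => ? ?; ring.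
  have b1 := bmM (bS j) bj.
  rewrite (meanD P1 (bmM (bS j) (bS j)) (bmD (bmZ 2 b1) (bmM bj bj))).
  rewrite (meanD P1 (bmZ 2 b1) (bmM bj bj)) (meanZ P1 2 b1).
  rewrite (mean_stationary j.+1 (bmM bf bf)).
  rewrite (cond_mean (Yst.2 j.+1) (in1 j) (pS j) bf)/= (mean_SF j (bm_kop k bf)).
  have bs := bm_poisson_sum k mu bg j.
  have -> : \sum_(0 <= i < j) mean mu (fun x => f x * iter i (kop k) (kop k f) x) =
      mean mu (fun x => f x * \sum_(0 <= i < j) poisson_term k mu g i x).
    elim: (j) => [|i IH].
      rewrite big_geq// (_ : (fun x => _) = fun=> 0) ?mean0//.
      by apply/funext => x; rewrite big_geq// mulr0.
    rewrite big_nat_recr//= IH -(meanD mu1); last 2 first.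
    - exact: bmM bf (bm_poisson_sum k mu bg i).
    - by apply: bmM => //; apply: bm_iter_kop; exact: bm_kop.
    congr mean; apply/funext => x; rewrite big_nat_recr//= mulrDr; congr (_ + _ * _).
    rewrite -iterSr /f (iter_kopB k i.+1 bg (bm_cst _ _)).
    by rewrite (iter_kop_cst k i.+1).
  have := @mean_approx _ _ _ mu mu1 (B * q ^+ j) _ _ (bmM bf bs) (bmM bf bphi) _.
  move=> /(_ _)/wrap[x|].
    rewrite -mulrBr normrM -mulrA ler_pM//.
    by rewrite distrC; exact: (poisson_approx q01 C0 erg bg gM).
  rewrite /sigma2; move: (mean mu _) (mean mu _) (mean mu _) (mean P _) => a b c e.
  rewrite -mulrA; move: (B * _) => h; rewrite !ler_norml; lra.
have -> : 2 * B / (1 - q) = 2 * B / (1 - q) * q ^+ 0 by rewrite mulr1.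
have -> : mean P (fun w => S n w * S n w) - n%:R * sigma2 =
    \sum_(0 <= j < n) (mean P (fun w => S j.+1 w * S j.+1 w) -
    mean P (fun w => S j w * S j w) - sigma2).
  elim: n => [|n IH].
    rewrite big_geq// mul0r subr0 (_ : (fun w => _) = fun=> 0) ?mean0//.
    by apply/funext => w; rewrite /S big_geq// mul0r.
  rewrite big_nat_recr//= -IH -natr1.
  by move: (mean _ _) (mean _ _) => ? ?; ring.
by apply: (geo_sum q01); rewrite // mulr_ge0.
Qed.

Let variance_sum n :
  fine 'V_P[fun w => \sum_(1 <= j < n.+1) g (Y j w)] = mean P (fun w => S n w * S n w).
Proof.
have bw : bm (fun w => \sum_(1 <= j < n.+1) g (Y j w)).
  by apply: bm_sum => j _; exact: (bm_rv Y j bg).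
have mw : mean P (fun w => \sum_(1 <= j < n.+1) g (Y j w)) = n%:R * mean mu g.
  elim: n {bw} => [|n IH].
    by under [X in mean _ X]funext do rewrite big_geq//; rewrite mean0 mul0r.
  under [X in mean _ X]funext do rewrite big_nat_recr//=.
  have b1 : bm (fun w => \sum_(1 <= j < n.+1) g (Y j w)).
    by apply: bm_sum => j _; exact: (bm_rv Y j bg).
  by rewrite (meanD P1 b1 (bm_rv Y n.+1 bg)) IH (mean_stationary n.+1 bg) -natr1 mulrDl mul1r.
rewrite /variance covariance.unlock expectation.unlock /mean /Rintegral.
congr fine; apply: eq_integral => w _; congr EFin => /=.
have -> : fine (\int[P]_w (\sum_(1 <= j < n.+1) g (Y j w))%:E)%E = n%:R * mean mu g.
  exact: mw.
have -> : S n w = \sum_(1 <= j < n.+1) g (Y j w) - n%:R * mean mu g.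
  by rewrite /S /f sumrB sumr_const_nat subSS subn0 mulr_natl.
by [].
Qed.

Lemma asymptotic_varianceE : asymptotic_variance Y g =
  2 * mean mu (fun x => f x ^+ 2 / 2 + f x * phi x).
Proof.
rewrite (meanD mu1 (_ : bm (fun x => f x ^+ 2 / 2)) (bmM bf bphi)); last first.
  have := bmZ 2^-1 (bmM bf bf); congr bm; apply/funext => x.
  by rewrite expr2 mulrC.
have -> : mean mu (fun x => f x ^+ 2 / 2) = 2^-1 * mean mu (fun x => f x * f x).
  rewrite -(meanZ mu1 _ (bmM bf bf)); congr mean; apply/funext => x.
  by rewrite expr2 mulrC.
have -> : 2 * (2^-1 * mean mu (fun x => f x * f x) + mean mu (fun x => f x * phi x)) =
  sigma2 by rewrite /sigma2; move: (mean mu _) (mean mu _) => ? ?; field.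
rewrite /asymptotic_variance; apply: cvg_lim => //.
have := S2; move: (_ / (1 - q)) => B SB.
apply/cvgrPdist_le => e e0; near=> n.
have n0 : 0 < (n%:R : R) by rewrite ltr0n; near: n; exact: nbhs_infty_gt.
rewrite variance_sum distrC; move: (SB n); move: (mean P _) => V SBV.
rewrite (_ : V / n%:R - sigma2 = (V - n%:R * sigma2) / n%:R); last first.
  by field; rewrite gt_eqF.
rewrite normrM normfV (gtr0_norm n0) ler_pdivrMr// (le_trans SBV)//.
rewrite -ler_pdivrMl//; near: n; exact: nbhs_infty_ger.
Unshelve. all: end_near. Qed.

End stationary_variance.

(** * Riemann sums of Lipschitz functions *)

Section riemann_sum.
Context (R : realType).
Variables (F : R -> R) (N : R).
Hypothesis N0 : 0 <= N.
Hypothesis FN : forall u v : R, u \in `[0, 1] -> v \in `[0, 1] ->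
  `|F u - F v| <= N * `|u - v|.
Local Notation mu := (@lebesgue_measure R).

(** F is controlled on [0, 1] only; composing it with this retraction gives a function Lipschitz on
    the whole line, hence continuous and integrable on every segment. *)
Let clamp (x : R) : R := Num.max 0 (Num.min 1 x).

Let clampI x : clamp x \in `[0, 1].
Proof.
by rewrite in_itv/= /clamp le_max lexx/= ge_max ler01/= ge_min lexx.
Qed.

Let clampE (x : R) : x \in `[0, 1] -> clamp x = x.
Proof.
by rewrite in_itv/= => /andP[x0 x1]; rewrite /clamp (min_idPr x1) (max_idPr x0).
Qed.

Let clamp_lip x y : `|clamp x - clamp y| <= `|x - y|.
Proof.
rewrite /clamp /Num.max /Num.min.
case: ifPn; case: ifPn; case: ifPn; case: ifPn; rewrite -?leNgt => h1 h2 h3 h4;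
  rewrite ler_norml; have := ler_norm (x - y); have := ler_norm (y - x);
  rewrite distrC => ? ?; lra.
Qed.

Let G x := F (clamp x).

Let G_lip x y : `|G x - G y| <= N * `|x - y|.
Proof. by rewrite (le_trans (FN _ _))// ler_wpM2l. Qed.

Let G_continuous : continuous G.
Proof.
move=> x; apply/cvgrPdist_le => e e0.
have h0 : 0 < e / (N + 1) by rewrite divr_gt0// ltr_wpDl.
near=> y; rewrite (le_trans (G_lip x y))//.
have : `|x - y| <= e / (N + 1) by near: y; exact: cvgr_dist_le.
rewrite ler_pdivlMr ?ltr_wpDl// mulrC; apply: le_trans.
by rewrite ler_wpM2r// lerDl.
Unshelve. all: end_near. Qed.

Let G_int (a b : R) : mu.-integrable `[a, b] (EFin \o G).
Proof.
apply: continuous_compact_integrable; first exact: segment_compact.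
exact: continuous_subspaceT.
Qed.

Let G_step (a b : R) : 0 <= a -> a <= b -> `|\int[mu]_(u in `]a, b]) G u -
  (b - a) * G b| <= N * (b - a) ^+ 2.
Proof.
move=> a0 ab; have ba : 0 <= b - a by rewrite subr_ge0.
have mab : mu `]a, b] = (b - a)%:E.
  rewrite lebesgue_measure_itv/= lte_fin; move: ab; rewrite le_eqVlt.
  by case: ltP => //= _ /predU1P[->|//]; rewrite subrr.
have iG : mu.-integrable `]a, b] (EFin \o G).
  by apply: integrableS (G_int a b) => //; apply: subset_itv; rewrite bnd_simp.
have ic (c : R) : mu.-integrable `]a, b] (EFin \o fun=> c).
  apply: measurable_bounded_integrable => //.
    by rewrite [ltLHS]mab ltry.
  by exists `|c|; split => // M cM y _ /=; exact: ltW.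
have Ic (c : R) : \int[mu]_(u in `]a, b]) c = c * (b - a).
  by rewrite Rintegral_cst//; congr (_ * _); rewrite [X in fine X]mab.
rewrite mulrC -Ic -RintegralB//.
have iB : mu.-integrable `]a, b] (EFin \o (fun u => G u - G b)).
  by apply: eq_integrable (integrableB _ iG (ic (G b))) => //.
apply: (le_trans (le_normr_Rintegral _ iB)) => //.
rewrite expr2 mulrA -Ic; apply: le_Rintegral => //.
  exact: (integrable_norm iB).
move=> u; rewrite /= in_itv/= => /andP[au ub].
rewrite (le_trans (G_lip u b))// ler_wpM2l// distrC ger0_norm ?subr_ge0//.
by rewrite lerD2l lerN2 ltW.
Qed.

(** Each of the n cells has error N / n after scaling, so the total stays bounded. An o(n) error
    would be too weak for the centring: multiplied by l = t c_n / n it has to be small against c_n^2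
    / n, so it must be o(c_n). *)
Lemma riemann_sum_lip n : (0 < n)%N ->
  `|\sum_(1 <= i < n.+1) F (i%:R / n%:R) -
    n%:R * \int[mu]_(u in `[0, 1]) F u| <= N.
Proof.
move=> n0; have n0' : 0 < (n%:R : R) by rewrite ltr0n.
have -> : \int[mu]_(u in `[0, 1]) F u = \int[mu]_(u in `[0, 1]) G u.
  by apply: eq_Rintegral => u; rewrite inE/= => uI; rewrite /G clampE.
have H j : (j <= n)%N -> `|\sum_(1 <= i < j.+1) F (i%:R / n%:R) -
    n%:R * \int[mu]_(u in `[0, (j%:R / n%:R)]) G u| <= j%:R * (N / n%:R).
  elim: j => [|j IH] jn.
    by rewrite big_geq// mul0r set_itv1 Rintegral_set1 mulr0 subrr normr0 mul0r.
  rewrite big_nat_recr//=.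
  have t0 : 0 <= (j%:R / n%:R : R) by rewrite divr_ge0.
  have tt : (j%:R / n%:R : R) <= j.+1%:R / n%:R.
    by rewrite ler_pM2r ?invr_gt0// ler_nat.
  have := @Rintegral_itvB R G (BLeft 0) (BRight (j.+1%:R / n%:R)) (j%:R / n%:R)
    (G_int _ _) _ _; rewrite !bnd_simp => /(_ t0 tt) E.
  have -> : F (j.+1%:R / n%:R) = G (j.+1%:R / n%:R).
    rewrite /G clampE// in_itv/= divr_ge0//= ler_pdivrMr// mul1r.
    by rewrite ler_nat.
  have := G_step t0 tt; rewrite -E.
  have -> : j.+1%:R / n%:R - j%:R / n%:R = (n%:R^-1 : R).
    by rewrite -mulrBl -natr1 addrAC subrr add0r mul1r.
  have -> : j.+1%:R * (N / n%:R) = j%:R * (N / n%:R) + N / n%:R.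
    by rewrite -natr1 mulrDl mul1r.
  move: (IH (ltnW jn)) (G _) => {}IH c Gc.
  move: IH Gc; move: (\int[_]_(_ in _) _) (\int[_]_(_ in _) _) (\sum_(_ <= _ < _) _).
  move=> IA IB s h1 h2.
  rewrite [X in `|X|](_ : _ = (s - n%:R * IB) - n%:R * (IA - IB - n%:R^-1 * c)); last first.
    by field; rewrite gt_eqF.
  rewrite (le_trans (ler_normB _ _))// lerD// normrM gtr0_norm//.
  rewrite (_ : N / n%:R = n%:R * (N * n%:R^-1 ^+ 2)); last by field; rewrite gt_eqF.
  by rewrite ler_pM2l.
have := H n (leqnn n); rewrite divff ?gt_eqF//.
by rewrite mulrCA mulfV ?gt_eqF// mulr1.
Qed.

End riemann_sum.

(** * From Gaussian generating functions to large deviations *)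

Section limits.
Context (R : realType).
Local Open Scope ereal_scope.

Lemma limn_esup_le_near (u : (\bar R) ^nat) (y : \bar R) :
  (\forall n \near \oo, u n <= y) -> limn_esup u <= y.
Proof.
move=> uy; apply: ereal_inf_le; exists (ereal_sup (u @` [set n | u n <= y])).
  by exists [set n | u n <= y].
by apply/ereal_supP => _ [n /= un <-].
Qed.

Lemma limn_einf_ge_near (u : (\bar R) ^nat) (y : \bar R) :
  (\forall n \near \oo, y <= u n) -> y <= limn_einf u.
Proof.
move=> uy; rewrite /limn_einf leeNr; apply: limn_esup_le_near.
by apply: filterS uy => n; rewrite leeN2.
Qed.

Lemma lne_scaled_ge (s y p : R) : (0 < s)%R -> (expR (s * y) <= p)%R ->
  y%:E <= (1 / s)%:E * lne p%:E.
Proof.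
move=> s0 yp; have p0 : (0 < p)%R by apply: lt_le_trans yp; exact: expR_gt0.
rewrite lne_EFin// -EFinM lee_fin div1r ler_pdivlMl//.
by rewrite -ler_expR lnK.
Qed.

Lemma lne_scaled_le (s y p : R) : (0 < s)%R -> (p <= expR (s * y))%R ->
  (1 / s)%:E * lne p%:E <= y%:E.
Proof.
(* A null probability has logarithm -oo, and the bound is then trivial. *)
move=> s0 yp; have [p0|p0] := ltP 0%R p; last first.
  by rewrite le0_lneNy// gt0_muleNy ?leNye// lte_fin divr_gt0.
rewrite lne_EFin// -EFinM lee_fin div1r ler_pdivrMl//.
by rewrite -ler_expR lnK.
Qed.

End limits.

Section gaussian_large_deviations.
Context (R : realType) (dX : nat -> measure_display)
  (OX : forall n, measurableType (dX n)) (PX : forall n, probability (OX n) R).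
Variables (Z : forall n, OX n -> R) (s : nat -> R) (a : R).
Hypotheses (bZ : forall n, bm (@Z n)) (a0 : 0 < a).
Hypothesis s_infty : s @ \oo --> +oo.

Let mgf n (t : R) := mean (PX n) (fun w : OX n => expR (s n * (t * Z w))).

(** The limit of the scaled logarithm, written without logarithms. Pointwise convergence in t is
    enough: each estimate below uses at most three values of t. *)
Hypothesis mgf_lim : forall t e : R, 0 < e -> \forall n \near \oo,
  expR (s n * (a ^+ 2 * t ^+ 2 / 2 - e)) <= mgf n t <=
  expR (s n * (a ^+ 2 * t ^+ 2 / 2 + e)).

Let P1 n : (PX n setT <= 1)%E. Proof. by rewrite probability_setT. Qed.

Let be n t : bm (fun w : OX n => expR (s n * (t * Z w))).
Proof. by apply: bm_expR; apply: bmZ; apply: bmZ; exact: bZ. Qed.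

Let s_gt0 : \forall n \near \oo, 0 < s n.
Proof. by move/cvgryPgt : s_infty; exact. Qed.

Let s_large (b e : R) : 0 < e -> \forall n \near \oo, b <= expR (s n * e).
Proof.
move=> e0; near=> n; apply: le_trans (expR_ge1Dx _).
rewrite -lerBlDl -ler_pdivrMr//; near: n.
by move/cvgryPge : s_infty; exact.
Unshelve. all: end_near. Qed.

Let prob n (A : set R) := fine (PX n [set w : OX n | A (Z w)]).

Let measurable_pre n (A : set R) : measurable A ->
  measurable [set w : OX n | A (Z w)].
Proof.
move=> mA; rewrite -[X in measurable X]setTI.
by apply: (bZ n).1.
Qed.

Let prob_mean n A : measurable A ->
  prob n A = mean (PX n) (\1_[set w : OX n | A (Z w)]).
Proof. by move=> mA; rewrite mean_indic//; exact: measurable_pre. Qed.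

Let prob_le n (A : set R) (f : OX n -> R) : measurable A -> bm f ->
  (forall w, A (Z w) -> 1 <= f w) -> (forall w, 0 <= f w) ->
  prob n A <= mean (PX n) f.
Proof.
move=> mA bf f1 f0; rewrite prob_mean//; apply: (mean_le (P1 n)) => //.
  by apply: bm_indic; exact: measurable_pre.
move=> w; rewrite indicE; case: (boolP (w \in _)) => wA; last by rewrite mulr0n.
by apply: f1; rewrite inE in wA.
Qed.

Let prob_ge n (A : set R) (f : OX n -> R) : measurable A -> bm f ->
  (forall w, A (Z w) -> f w <= 1) -> (forall w, ~ A (Z w) -> f w <= 0) ->
  mean (PX n) f <= prob n A.
Proof.
move=> mA bf f1 f0; rewrite prob_mean//; apply: (mean_le (P1 n)) => //.
  by apply: bm_indic; exact: measurable_pre.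
move=> w; rewrite indicE; case: (boolP (w \in _)) => wA; rewrite ?mulr1n ?mulr0n.
  by apply: f1; rewrite inE in wA.
by apply: f0; rewrite notin_setE in wA.
Qed.

(** A is contained in the set where |x| >= D with D^2 = 2 a^2 v. Chernoff's inequality is applied to
    both tails at once, and the factor 2 is absorbed by half of e. *)
Lemma tail_upper (A : set R) (v e : R) : measurable A -> 0 <= v -> 0 < e ->
  (forall x, A x -> v <= x ^+ 2 / (2 * a ^+ 2)) ->
  \forall n \near \oo, prob n A <= expR (s n * (- v + e)).
Proof.
move=> mA v0 e0 Av.
have a20 : 0 < a ^+ 2 by rewrite exprn_gt0.
pose D := Num.sqrt (2 * a ^+ 2 * v).
have D0 : 0 <= D by exact: sqrtr_ge0.
have D2 : D ^+ 2 = 2 * a ^+ 2 * v by rewrite sqr_sqrtr// !mulr_ge0// ltW.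
have AD x : A x -> D <= `|x|.
  move=> /Av; rewrite ler_pdivlMr ?mulr_gt0// mulrC -D2 -[x ^+ 2]real_normK ?num_real//.
  by rewrite ler_pXn2r ?nnegrE.
(* The minimiser of a^2 t^2 / 2 - t D, whose minimum is -v. *)
pose t := D / a ^+ 2.
have e2 : 0 < e / 2 by rewrite divr_gt0.
near=> n.
have sn : 0 < s n by near: n; exact: s_gt0.
have t0 : 0 <= t by rewrite divr_ge0// ltW.
have /andP[_ h1] : expR (s n * (a ^+ 2 * t ^+ 2 / 2 - e / 2)) <= mgf n t <=
  expR (s n * (a ^+ 2 * t ^+ 2 / 2 + e / 2)) by near: n; exact: mgf_lim.
have /andP[_ h2] : expR (s n * (a ^+ 2 * (- t) ^+ 2 / 2 - e / 2)) <= mgf n (- t) <=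
  expR (s n * (a ^+ 2 * (- t) ^+ 2 / 2 + e / 2)) by near: n; exact: mgf_lim.
have h3 : 2 <= expR (s n * (e / 2)) by near: n; exact: s_large.
pose f (w : OX n) := expR (- (s n * (t * D))) *
  (expR (s n * (t * Z w)) + expR (s n * (- t * Z w))).
have bf : bm f by apply: bmZ; apply: bmD; exact: be.
have pf : prob n A <= mean (PX n) f.
  apply: prob_le => // w; last by rewrite mulr_ge0 ?addr_ge0 ?expR_ge0.
  move=> /AD Dz; rewrite /f mulrDr -!expRD.
  have sDz : 0 <= s n * (t * (`|Z w| - D)).
    by apply: mulr_ge0; [exact: ltW|apply: mulr_ge0; rewrite ?subr_ge0].
  have := expR_ge0 (- (s n * (t * D)) + s n * (t * Z w)).
  have := expR_ge0 (- (s n * (t * D)) + s n * (- t * Z w)).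
  have : 1 <= expR (s n * (t * (`|Z w| - D))) by rewrite -expR0 ler_expR.
  case: (ler0P (Z w)) => Z0.
    rewrite (_ : s n * (t * (- Z w - D)) =
      - (s n * (t * D)) + s n * (- t * Z w)); last by ring.
    move: (expR _) (expR _) => ? ?; lra.
  rewrite (_ : s n * (t * (Z w - D)) =
    - (s n * (t * D)) + s n * (t * Z w)); last by ring.
  move: (expR _) (expR _) => ? ?; lra.
apply: (le_trans pf); rewrite (meanZ (P1 n) _ (bmD (be n t) (be n (- t)))).
rewrite (meanD (P1 n) (be n t) (be n (- t))) -/(mgf n t) -/(mgf n (- t)).
rewrite sqrrN in h2.
apply: (@le_trans _ _ (expR (- (s n * (t * D))) *
  (expR (s n * (e / 2)) * expR (s n * (a ^+ 2 * t ^+ 2 / 2 + e / 2))))).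
  rewrite ler_wpM2l ?expR_ge0//.
  apply: (@le_trans _ _ (2 * expR (s n * (a ^+ 2 * t ^+ 2 / 2 + e / 2)))).
    by rewrite mulr_natl mulr2n lerD.
  by rewrite ler_wpM2r ?expR_ge0.
rewrite -!expRD ler_expR.
have -> : v = D ^+ 2 / (2 * a ^+ 2) by rewrite D2; field; rewrite gt_eqF.
rewrite [leLHS](_ : _ = s n * (- (D ^+ 2 / (2 * a ^+ 2)) + e))// /t.
by field; rewrite gt_eqF.
Unshelve. all: end_near. Qed.

(* Tilting by t = x / a^2 centres Z at x; shifting t by +- D / a^2 shows that
   the tilted mass outside the ball of radius D is negligible. *)
Lemma ball_lower (A : set R) (x h e : R) : measurable A -> 0 < h -> 0 < e ->
  (forall y, `|y - x| < h -> A y) ->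
  \forall n \near \oo, expR (s n * (- (x ^+ 2 / (2 * a ^+ 2)) - e)) <= prob n A.
Proof.
move=> mA h0 e0 hA.
have a20 : 0 < a ^+ 2 by rewrite exprn_gt0.
pose t := x / a ^+ 2.
(* D <= h keeps the ball inside A; |t| D <= e / 2 bounds what undoing the tilt costs in the
   exponent. *)
have [D [D0 Dh tD]] : exists D, [/\ 0 < D, D <= h & `|t| * D <= e / 2].
  exists (Num.min h (e / 2 / (`|t| + 1))); split.
  - by rewrite lt_min h0/= !divr_gt0// ltr_wpDl.
  - by rewrite ge_min lexx.
  - apply: (@le_trans _ _ (`|t| * (e / 2 / (`|t| + 1)))).
      by rewrite ler_wpM2l// ge_min lexx orbT.
    rewrite mulrA ler_pdivrMr ?ltr_wpDl// [leLHS]mulrC.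
    by apply: ler_wpM2l; [apply: ltW; rewrite divr_gt0|rewrite lerDl].
pose eta := D / a ^+ 2.
(* The gain in the exponent from shifting the tilt by eta; it makes the mass off the ball
   negligible. *)
pose kap := D ^+ 2 / (2 * a ^+ 2).
have kap0 : 0 < kap by rewrite divr_gt0 ?exprn_gt0 ?mulr_gt0.
(* The first bound keeps the off-ball terms below the main one even after a factor 4; the second
   gives |t| D + 2 e' <= e. *)
pose e' := Num.min (kap / 4) (e / 4).
have e'0 : 0 < e' by rewrite lt_min; apply/andP; split; lra.
have k2 : 0 < kap / 2 by rewrite divr_gt0.
have e'k : e' <= kap / 4 by rewrite ge_min lexx.
have e'e : e' <= e / 4 by rewrite ge_min lexx orbT.
near=> n.
have sn : 0 < s n by near: n; exact: s_gt0.
have /andP[m1 _] : expR (s n * (a ^+ 2 * t ^+ 2 / 2 - e')) <= mgf n t <=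
  expR (s n * (a ^+ 2 * t ^+ 2 / 2 + e')) by near: n; exact: mgf_lim.
have /andP[_ m2] : expR (s n * (a ^+ 2 * (t + eta) ^+ 2 / 2 - e')) <= mgf n (t + eta) <=
  expR (s n * (a ^+ 2 * (t + eta) ^+ 2 / 2 + e')) by near: n; exact: mgf_lim.
have /andP[_ m3] : expR (s n * (a ^+ 2 * (t - eta) ^+ 2 / 2 - e')) <= mgf n (t - eta) <=
  expR (s n * (a ^+ 2 * (t - eta) ^+ 2 / 2 + e')) by near: n; exact: mgf_lim.
have h4 : 4 <= expR (s n * (kap / 2)) by near: n; exact: s_large.
have h5 : 2 <= expR (s n * e') by near: n; exact: (s_large 2 e'0).
(* f will minorise the indicator of the ball. Where Z >= x + D the term with q1 dominates e^(s t Z),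
   where Z <= x - D the one with q2 does, so f <= 0 off the ball; q0 makes f <= 1 on it. *)
pose q1 := expR (- (s n * (eta * (x + D)))).
pose q2 := expR (s n * (eta * (x - D))).
pose q0 := expR (- (s n * (t * x + `|t| * D))).
pose f (w : OX n) := q0 * (expR (s n * (t * Z w)) -
  (q1 * expR (s n * ((t + eta) * Z w)) + q2 * expR (s n * ((t - eta) * Z w)))).
have eta0 : 0 < eta by rewrite divr_gt0.
have b1 := bmZ q1 (be n (t + eta)); have b2 := bmZ q2 (be n (t - eta)).
have bf : bm f by apply: bmZ; apply: bmB => //; exact: bmD.
have f1 w : `|Z w - x| < D -> f w <= 1.
  move=> Zx; apply: (@le_trans _ _ (q0 * expR (s n * (t * Z w)))).
    by rewrite ler_wpM2l ?expR_ge0// gerBl addr_ge0// mulr_ge0 ?expR_ge0.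
  rewrite /q0 -expRD -expR0 ler_expR [leLHS](_ : _ =
    s n * (t * (Z w - x) - `|t| * D)); last by ring.
  rewrite pmulr_rle0// subr_le0 (le_trans (ler_norm _))// normrM ler_wpM2l//.
  exact: ltW.
have f0 w : D <= `|Z w - x| -> f w <= 0.
  move=> Zx; rewrite /f pmulr_rle0 ?expR_gt0// subr_le0 /q1 /q2 -!expRD.
  have := expR_ge0 (- (s n * (eta * (x + D))) + s n * ((t + eta) * Z w)).
  have := expR_ge0 (s n * (eta * (x - D)) + s n * ((t - eta) * Z w)).
  move: Zx; case: (ler0P (Z w - x)) => _ Zx g1 g2.
    have : expR (s n * (t * Z w)) <= expR (s n * (eta * (x - D)) + s n * ((t - eta) * Z w)).
      rewrite ler_expR -subr_ge0 [leRHS](_ : _ = s n * (eta * (- (Z w - x) - D))); last by ring.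
      apply: mulr_ge0; first exact: ltW.
      by apply: mulr_ge0; [exact: ltW|rewrite subr_ge0].
    by move=> /le_trans; apply; rewrite lerDr.
  have : expR (s n * (t * Z w)) <= expR (- (s n * (eta * (x + D))) + s n * ((t + eta) * Z w)).
    rewrite ler_expR -subr_ge0 [leRHS](_ : _ = s n * (eta * ((Z w - x) - D))); last by ring.
    apply: mulr_ge0; first exact: ltW.
    by apply: mulr_ge0; [exact: ltW|rewrite subr_ge0].
  by move=> /le_trans; apply; rewrite lerDl.
have pf : mean (PX n) f <= prob n A.
  apply: prob_ge => // w Aw.
    have [Zx|Zx] := ltP `|Z w - x| D; first exact: f1.
    by rewrite (le_trans (f0 w Zx)).
  apply: f0; rewrite leNgt; apply/negP => Zx; apply: Aw; apply: hA.
  exact: lt_le_trans Zx Dh.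
apply: le_trans pf.
rewrite (meanZ (P1 n) q0 (bmB (be n t) (bmD b1 b2))).
rewrite (meanB (P1 n) (be n t) (bmD b1 b2)) (meanD (P1 n) b1 b2).
rewrite (meanZ (P1 n) q1 (be n (t + eta))) (meanZ (P1 n) q2 (be n (t - eta))).
rewrite -/(mgf n t) -/(mgf n (t + eta)) -/(mgf n (t - eta)).
pose G := a ^+ 2 * t ^+ 2 / 2.
have E1 : q1 * mgf n (t + eta) <= expR (s n * (G - kap + e')).
  apply: (le_trans (ler_wpM2l (expR_ge0 _) m2)); rewrite -expRD ler_expR.
  rewrite [leLHS](_ : _ = s n * (G - kap + e'))// /G /kap /t /eta.
  by field; rewrite gt_eqF.
have E2 : q2 * mgf n (t - eta) <= expR (s n * (G - kap + e')).
  apply: (le_trans (ler_wpM2l (expR_ge0 _) m3)); rewrite -expRD ler_expR.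
  rewrite [leLHS](_ : _ = s n * (G - kap + e'))// /G /kap /t /eta.
  by field; rewrite gt_eqF.
have E3 : 4 * expR (s n * (G - kap + e')) <= expR (s n * (G - e')).
  apply: (le_trans (ler_wpM2r (expR_ge0 _) h4)); rewrite -expRD ler_expR -mulrDr.
  by rewrite ler_pM2l//; lra.
have E4 : 2 * expR (s n * (G - 2 * e')) <= expR (s n * (G - e')).
  apply: (le_trans (ler_wpM2r (expR_ge0 _) h5)); rewrite -expRD ler_expR -mulrDr.
  by rewrite ler_pM2l//; lra.
apply: (@le_trans _ _ (q0 * expR (s n * (G - 2 * e')))).
  rewrite /q0 -expRD ler_expR [leRHS](_ : _ =
    s n * (- (x ^+ 2 / (2 * a ^+ 2)) - `|t| * D - 2 * e')).
    by rewrite ler_pM2l//; lra.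
  by rewrite /G /t; field; rewrite gt_eqF.
rewrite ler_wpM2l ?expR_ge0//.
move: m1 E1 E2 E3 E4; rewrite -/G.
move: (expR _) (expR _) (expR _) (mgf n t) (q1 * _) (q2 * _) => ? ? ? ? ? ?; lra.
Unshelve. all: end_near. Qed.

Let probE n A : measurable A -> PX n [set w : OX n | A (Z w)] = (prob n A)%:E.
Proof.
by move=> mA; rewrite /prob fineK//; exact: (le1_fin_num (P1 n) (measurable_pre n mA)).
Qed.

Lemma gaussian_ldp_open (A : set R) : open A ->
  (- gaussian_rate a A <= limn_einf (fun n =>
    (1 / s n)%:E * lne (PX n [set w : OX n | A (Z w)])))%E.
Proof.
move=> oA; have mA : measurable A by exact: open_measurable.
rewrite leeNl; apply/ereal_infP => _ [x Ax <-].
rewrite leeNl -EFinN; apply/lee_subgt0Pr => e e0; rewrite -EFinB.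
have /nbhs_ballP[h /= h0 hA] : nbhs x A by exact: open_nbhs_nbhs.
apply: limn_einf_ge_near.
have {}hA y : `|y - x| < h -> A y by rewrite distrC; exact: hA.
have H := @ball_lower A x h e mA h0 e0 hA.
near=> n; rewrite probE//; apply: lne_scaled_ge; first by near: n; exact: s_gt0.
by near: n.
Unshelve. all: end_near. Qed.

Lemma gaussian_ldp_closed (A : set R) : closed A ->
  (limn_esup (fun n =>
    (1 / s n)%:E * lne (PX n [set w : OX n | A (Z w)])) <= - gaussian_rate a A)%E.
Proof.
move=> cA; have mA : measurable A by exact: closed_measurable.
have rate_ge0 : (0 <= gaussian_rate a A)%E.
  apply/ereal_infP => _ [x Ax <-]; rewrite lee_fin divr_ge0 ?sqr_ge0//.
  by rewrite mulr_ge0// sqr_ge0.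
have rate_le x : A x -> (gaussian_rate a A <= (x ^+ 2 / (2 * a ^+ 2))%:E)%E.
  by move=> Ax; apply: ereal_inf_lbound; exists x.
case: (gaussian_rate a A) rate_ge0 rate_le => [v||]//= v0 vA.
- apply/lee_addgt0Pr => e e0; rewrite -EFinD.
  apply: limn_esup_le_near.
  have H := @tail_upper A v e mA v0 e0 (fun x Ax => vA x Ax).
  near=> n; rewrite probE//; apply: lne_scaled_le; first by near: n; exact: s_gt0.
  by near: n.
(* The rate of any point is finite, so an infinite infimum means that A is empty. *)
- apply: limn_esup_le_near; near=> n.
  rewrite (_ : [set w | A (Z w)] = set0).
    by rewrite measure0 le0_lneNy// gt0_muleNy// lte_fin divr_gt0//; near: n; exact: s_gt0.
  by apply/seteqP; split => // w /vA; rewrite leye_eq.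
Unshelve. all: end_near. Qed.

End gaussian_large_deviations.

(** * Assembly at the moderate deviation scale *)

Lemma moderate_error (R : realType) (n c t s l eps e K N B : R) :
  0 < n -> 0 < c -> 0 <= K -> 0 <= N -> 0 <= B ->
  s = c ^+ 2 / n -> l = t * c / n ->
  n^-1 <= eps -> c / n <= eps -> c^-1 <= eps -> s^-1 <= eps ->
  eps * (t ^+ 2 * N + K * `|t| ^+ 3 + (K + B) * `|t| + 3) <= e ->
  l ^+ 2 * N + K * (n * `|l| ^+ 3 + `|l|) + `|l| * B + 3 <= s * e.
Proof.
move=> n0 c0 K0 N0 B0 sE lE n1 cn c1 s1 He.
have s0 : 0 < s by rewrite sE divr_gt0// exprn_gt0.
have t0 : 0 <= `|t| by [].
have lt : `|l| = `|t| * c / n by rewrite lE !normrM normfV (gtr0_norm n0) (gtr0_norm c0).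
(* Relative to s, the terms l^2, n |l|^3, |l| and 1 have sizes t^2 / n, |t|^3 c / n, |t| / c and 1 /
   s. *)
rewrite lt lE [leLHS](_ : _ = s * (t ^+ 2 * N * n^-1 +
  (K * (`|t| ^+ 3 * (c / n)) + (K + B) * (`|t| * c^-1)) + 3 * s^-1)); last first.
  by rewrite sE; field; rewrite !gt_eqF.
rewrite ler_pM2l//; apply: le_trans He.
have T2 : 0 <= t ^+ 2 by exact: sqr_ge0.
have T3 : 0 <= `|t| ^+ 3 by exact: exprn_ge0.
rewrite [leRHS](_ : _ = t ^+ 2 * N * eps + (K * (`|t| ^+ 3 * eps) +
  (K + B) * (`|t| * eps)) + 3 * eps); last by ring.
have KB : 0 <= K + B by exact: addr_ge0.
apply: lerD; last by rewrite ler_pM2l.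
apply: lerD; first by rewrite ler_wpM2l// mulr_ge0.
by apply: lerD; apply: ler_wpM2l => //; exact: ler_wpM2l.
Qed.

(** The 3 pays for the prefactor: 4 = 1 + 3 <= e^3. *)
Lemma expR_sandwich (R : realType) (x y z M lo hi : R) :
  `|x - y| + z + 3 <= hi - y -> `|x - y| + z + 3 <= y - lo ->
  expR (x - z) / 4 <= M <= expR (x + z) * 4 -> expR lo <= M <= expR hi.
Proof.
move=> h1 h2 /andP[m1 m2].
have e3 : 4 <= expR (3 : R) by rewrite (le_trans _ (expR_ge1Dx _))//; lra.
have := ler_norm (x - y); have := ler_norm (y - x); rewrite distrC => n1 n2.
apply/andP; split.
  apply: le_trans m1; rewrite ler_pdivlMr//.
  rewrite (le_trans (ler_wpM2l (expR_ge0 _) e3))// -expRD ler_expR; lra.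
apply: (le_trans m2); rewrite (le_trans (ler_wpM2l (expR_ge0 _) e3))// -expRD ler_expR.
lra.
Qed.

Theorem theorem10 (R : realType) (E : pointedMetricType R)
  (Q : R -> R.-pker (borel E) ~> (borel E))
  (g : R -> E -> R)
  (L K Cg r : R) (m : nat)
  (mg : measurable_fun ([set` `[0, 1]] `*` setT : set (R * borel E))
          (fun p : R * borel E => g p.1 p.2))
  (L0 : 0 < L)
  (Qlip : forall (u v : R) x, u \in `[0, 1] -> v \in `[0, 1] ->
     (tv_dist (Q u x) (Q v x) <= (L * `|u - v|)%:E)%E)
  (m1 : (1 <= m)%N) (r01 : 0 < r < 1)
  (Qmix : forall (u : R) x y, u \in `[0, 1] ->
     (tv_dist (kiter (Q u) m x) (kiter (Q u) m y) <= r%:E)%E)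
  (gbnd : forall (u : R) x, u \in `[0, 1] -> `|g u x| <= K)
  (Cg0 : 0 <= Cg)
  (glip : forall (u v : R) x, u \in `[0, 1] -> v \in `[0, 1] ->
     `|g u x - g v x| <= Cg * `|u - v|)
  (pi_ : R -> probability (borel E) R)
  (pi_inv : forall u : R, u \in `[0, 1] -> invariant_measure (Q u) (pi_ u))
  (dX : nat -> measure_display) (OX : forall n, measurableType (dX n))
  (PX : forall n, probability (OX n) R)
  (X : forall n, nat -> {RV (PX n) >-> borel E})
  (X_chain : forall n, (1 <= n)%N ->
     markov_chain (fun k => Q (k%:R / n%:R)) (pi_ 0) n (X n))
  (dY : R -> measure_display) (OY : forall u, measurableType (dY u))
  (PY : forall u, probability (OY u) R)
  (Y : forall u, nat -> {RV (PY u) >-> borel E})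
  (Y_chain : forall u : R, u \in `[0, 1] -> stationary_chain (Q u) (pi_ u) (Y u))
  (a b : R)
  (bE : b = \int[lebesgue_measure]_(u in `[0, 1]) \int[pi_ u]_x g u x)
  (aE : a ^+ 2 = \int[lebesgue_measure]_(u in `[0, 1])
                    asymptotic_variance (Y u) (g u))
  (a0 : 0 < a)
  (c : nat -> R)
  (c_sqrt : (fun n => c n / Num.sqrt n%:R) @ \oo --> +oo)
  (c_lin : (fun n => c n / n%:R) @ \oo --> 0) :
  let Sn n w := \sum_(1 <= k < n.+1) g (k%:R / n%:R) (X n k w) in
  let log_prob (Gamma : set R) n : \bar R :=
    ((1 / (c n ^+ 2 / n%:R))%:E *
     lne (PX n [set w | Gamma ((Sn n w - b * n%:R) / c n)%R]))%E in
  (forall Gamma : set R, open Gamma ->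
     (- gaussian_rate a Gamma <= limn_einf (log_prob Gamma))%E) /\
  (forall Gamma : set R, closed Gamma ->
     (limn_esup (log_prob Gamma) <= - gaussian_rate a Gamma)%E).
Proof.
move=> Sn log_prob.
have /andP[r0 r1] := r01.
have q01 := mix_ratio01 m1 r01.
have C0 : 0 <= 2 / r by rewrite divr_ge0// ltW.
have klip : forall (u v : R) (f : borel E -> R) (M : R) x,
    u \in `[0, 1] -> v \in `[0, 1] -> bm f -> (forall x, `|f x| <= M) ->
    `|kop (Q u) f x - kop (Q v) f x| <= L * `|u - v| * M.
  move=> u v f M x uI vI bf fM.
  by apply: tv_dist_mean => //; [rewrite prob_kernel|rewrite prob_kernel|exact: Qlip].
have mix (u : R) : u \in `[0, 1] -> forall (f : borel E -> R) (M : R) x y, bm f ->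
    (forall x, `|f x| <= M) -> `|iter m (kop (Q u)) f x - iter m (kop (Q u)) f y| <= r * M.
  move=> uI f M x y bf fM; rewrite -!mean_kiter//.
  by apply: tv_dist_mean => //; [exact: kiter1|exact: kiter1|exact: Qmix].
have erg : forall (u : R) (f : borel E -> R) (M : R) n x, u \in `[0, 1] ->
    bm f -> (forall x, `|f x| <= M) ->
    `|iter n (kop (Q u)) f x - mean (pi_ u) f| <= 2 / r * mix_ratio r m ^+ n * M.
  move=> u f M n x uI bf fM.
  by apply: kop_ergodic => //; [exact: mix|exact: pi_inv].
have bg (u : R) : u \in `[0, 1] -> bm (g u : borel E -> R).
  move=> uI; split; last by exists K => x; exact: gbnd.
  have mD : measurable ([set` `[0, 1]] `*` setT : set (R * borel E)).
    by apply: measurableX => //; exact: measurable_itv.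
  have sD : pair u @` (setT : set (borel E)) `<=` [set` `[0, 1]] `*` setT.
    by move=> _ [x _ <-].
  exact: (measurable_comp mD sD mg (@measurable_pair1 _ _ R (borel E) u)).
have lipg : lipfam (g : R -> borel E -> R).
  exists `|K|, Cg; split => // u uI; split => [|x|v vI x]; first exact: bg.
  - by rewrite (le_trans (gbnd u x uI))// ler_norm.
  - exact: glip.
have [M1 [N1 [_ N10 barlip]]] := lipfam_mean q01 C0 (ltW L0) pi_inv erg klip lipg.
have [D [N DN]] := bound_all_ex q01 C0 (ltW L0) pi_inv erg klip lipg.
have [D1 N0 HDN] := DN.
have barR n := riemann_sum_lip N10
  (fun u v uI vI => (let: And3 _ _ H := barlip u uI in H) v vI point) (n := n).
pose hv := half_variance Q pi_ g.
have varR n : (0 < n)%N -> `|\sum_(1 <= i < n.+1) hv (i%:R / n%:R) -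
    n%:R * (a ^+ 2 / 2)| <= N.
  move=> n0; have -> : a ^+ 2 = \int[lebesgue_measure]_(u in `[0, 1]) (2 * hv u).
    rewrite aE; apply: eq_Rintegral => u; rewrite inE/= => uI.
    exact: (asymptotic_varianceE q01 C0 (pi_inv u uI)
      (fun f M n x => @erg u f M n x uI) (bg u uI) (fun x => gbnd u x uI) (Y_chain u uI)).
  (* The doubled function is the one whose integral is a^2; halving its error bound 2 N gives N. *)
  have := @riemann_sum_lip R (fun u => 2 * hv u) (2 * N) _ _ n n0.
  move=> /(_ _ _)/wrap[||].
  - by rewrite mulr_ge0.
  - move=> u v uI vI; rewrite -mulrBr normrM ger0_norm// -mulrA ler_wpM2l//.
    by have [_ _ _ _ /(_ v vI)[_ _]] := HDN u uI.
  - rewrite -mulr_sumr; move: (\sum_(_ <= _ < _) _) (Rintegral _ _ _) => S I.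
    rewrite (_ : 2 * S - n%:R * I = 2 * (S - n%:R * (I / 2))); last by field.
    by rewrite normrM ger0_norm// ler_pM2l.
pose s n := c n ^+ 2 / n%:R.
have sE n : (0 < n)%N -> s n = (c n / Num.sqrt n%:R) ^+ 2.
  by move=> n0; rewrite exprMn exprVn sqr_sqrtr.
have s_infty : s @ \oo --> +oo.
  apply/cvgryPge => A; near=> n.
  have n0 : (0 < n)%N by near: n; exact: nbhs_infty_gt.
  (* Once this ratio is at least 1, it is at most its square, which is s n. *)
  have c1 : Num.max 1 A <= c n / Num.sqrt n%:R.
    by near: n; move/cvgryPge : c_sqrt; exact.
  rewrite sE//; move: c1; rewrite ge_max => /andP[c1 c2].
  by rewrite (le_trans c2)// expr2 ler_peMr// (le_trans _ c1).
have c_infty : c @ \oo --> +oo.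
  apply/cvgryPge => A; near=> n.
  have n0 : (0 < n)%N by near: n; exact: nbhs_infty_gt.
  have c1 : Num.max 1 A <= c n / Num.sqrt n%:R.
    by near: n; move/cvgryPge : c_sqrt; exact.
  move: c1; rewrite ge_max => /andP[c1 c2].
  have n1 : 1 <= Num.sqrt (n%:R : R) by rewrite -[leLHS]sqrtr1 ler_wsqrtr// ler1n.
  rewrite (le_trans c2)// ler_pdivrMr ?(lt_le_trans _ n1)// ler_peMr//.
  rewrite -(divfK (_ : Num.sqrt (n%:R : R) != 0) (c n)) ?gt_eqF ?(lt_le_trans _ n1)//.
  by rewrite mulr_ge0// ?sqrtr_ge0// (le_trans _ c1).
pose Z n (w : OX n) := (Sn n w - b * n%:R) / c n.
have tI (n i : nat) : (1 <= i <= n)%N -> i%:R / n%:R \in `[0, (1 : R)].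
  move=> /andP[i1 iN]; rewrite in_itv/= divr_ge0//= ler_pdivrMr ?mul1r ?ler_nat//.
  by rewrite ltr0n (leq_trans i1).
have bS n : bm (Sn n).
  apply: bm_sum => i; rewrite mem_index_iota => /andP[i1 iN].
  by apply: (bm_rv (X n) i); apply: bg; apply: tI; rewrite i1.
have bZ n : bm (@Z n).
  have := bmZ (c n)^-1 (bmB (bS n) (bm_cst _ (b * n%:R))).
  by congr bm; apply/funext => w; rewrite /Z mulrC.
have mgf_lim t e : 0 < e -> \forall n \near \oo,
    expR (s n * (a ^+ 2 * t ^+ 2 / 2 - e)) <=
      mean (PX n) (fun w => expR (s n * (t * Z n w))) <=
    expR (s n * (a ^+ 2 * t ^+ 2 / 2 + e)).
  move=> e0.
  pose K0 := 32 * D ^+ 3 + 32 * N.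
  have K00 : 0 <= K0.
    by apply: addr_ge0; apply: mulr_ge0 => //; rewrite exprn_ge0// (le_trans _ D1).
  pose T := t ^+ 2 * N + K0 * `|t| ^+ 3 + (K0 + N1) * `|t| + 3.
  have T0 : 0 < T.
    have h1 : 0 <= t ^+ 2 * N by rewrite mulr_ge0// sqr_ge0.
    have h2 : 0 <= K0 * `|t| ^+ 3 by rewrite mulr_ge0// exprn_ge0.
    have h3 : 0 <= (K0 + N1) * `|t| by rewrite mulr_ge0// addr_ge0.
    by rewrite ltr_wpDl// !addr_ge0.
  pose V := `|t| * (D + N) + 1.
  have DN0 : 0 <= D + N by rewrite addr_ge0// (le_trans _ D1).
  have V0 : 0 < V by rewrite ltr_wpDl// mulr_ge0.
  (* The first bound keeps the total error below s n times e; the second makes l small enough for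
     the eigenfunction estimates. *)
  pose eps := Num.min (e / T) (64^-1 / V).
  have eps0 : 0 < eps by rewrite lt_min !divr_gt0.
  near=> n.
  have n0 : (0 < n)%N by near: n; exact: nbhs_infty_gt.
  have n0' : 0 < (n%:R : R) by rewrite ltr0n.
  have c0 : 0 < c n by near: n; move/cvgryPgt : c_infty; exact.
  have s0 : 0 < s n by rewrite divr_gt0// exprn_gt0.
  have n1 : n%:R^-1 <= eps.
    rewrite invf_ple ?posrE//; near: n; exact: nbhs_infty_ger.
  have cn : c n / n%:R <= eps.
    rewrite (le_trans (ler_norm _))//; near: n.
    by move/cvgr0Pnorm_le : c_lin; exact.
  have c1 : (c n)^-1 <= eps.
    rewrite invf_ple ?posrE//; near: n; by move/cvgryPge : c_infty; exact.
  have s1 : (s n)^-1 <= eps.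
    rewrite invf_ple ?posrE//; near: n; by move/cvgryPge : s_infty; exact.
  pose l := t * c n / n%:R.
  have lDN : `|l| * (D + N) <= 64^-1.
    have lt : `|l| = `|t| * (c n / n%:R).
      by rewrite /l -mulrA normrM (gtr0_norm (divr_gt0 c0 n0')).
    have : `|t| * (c n / n%:R) * (D + N) <= eps * V.
      rewrite mulrAC [leRHS]mulrC; apply: ler_pM => //.
      - exact: mulr_ge0.
      - by rewrite divr_ge0// ltW.
      - by rewrite /V lerDl.
    rewrite lt => /le_trans; apply; rewrite -ler_pdivlMr//.
    by rewrite ge_min lexx orbT.
  have He : eps * T <= e by rewrite -ler_pdivlMr// ge_min lexx.
  have err := moderate_error n0' c0 K00 N0 N10 (erefl (s n)) (erefl l) n1 cn c1 s1 He.
  have := mgf_bound q01 C0 (ltW L0) pi_inv erg klip lipg DN n0 (X_chain n n0) lDN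
    (erefl K0) erefl erefl.
  rewrite -/hv -/K0; set S := \sum_(1 <= i < n.+1) hv _.
  set MM := mean _ _ => mgfb.
  (* The gap between centring by the running means and centring by n b: deterministic and bounded in
     n, it enters as the factor e^(l B). *)
  pose B := \sum_(1 <= i < n.+1) mean (pi_ (i%:R / n%:R)) (g (i%:R / n%:R)) - n%:R * b.
  have BN : `|B| <= N1 by rewrite /B bE; exact: barR.
  have bC : bm (fun w => \sum_(1 <= i < n.+1) centered pi_ g (i%:R / n%:R) (X n i w)).
    apply: bm_sum => i; rewrite mem_index_iota => /andP[i1 iN].
    apply: (bm_rv (X n) i); apply: bmB; last exact: bm_cst.
    by apply: bg; apply: tI; rewrite i1.
  have P1 : (PX n setT <= 1)%E by rewrite probability_setT.
  have -> : mean (PX n) (fun w => expR (s n * (t * Z n w))) = expR (l * B) * MM.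
    rewrite -(meanZ P1 _ (bm_expR (bmZ l bC))).
    congr mean; apply/funext => w; rewrite -expRD -mulrDr; congr expR.
    have -> : B + \sum_(1 <= i < n.+1) centered pi_ g (i%:R / n%:R) (X n i w) =
        Sn n w - b * n%:R.
      rewrite /B /Sn /centered sumrB [b * _]mulrC.
      by move: (\sum_(_ <= _ < _) _) (\sum_(_ <= _ < _) _) (n%:R * b) => ? ? ?; ring.
    by rewrite /Z /s /l; move: (Sn n w - _) => ?; field; rewrite !gt_eqF.
  have /andP[mg1 mg2] := mgfb.
  have lB : `|l * B| <= `|l| * N1 by rewrite normrM ler_wpM2l.
  have SN : `|l ^+ 2 * S - s n * (a ^+ 2 * t ^+ 2 / 2)| <= l ^+ 2 * N.
    have -> : s n * (a ^+ 2 * t ^+ 2 / 2) = l ^+ 2 * (n%:R * (a ^+ 2 / 2)).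
      by rewrite /s /l; field; rewrite gt_eqF.
    rewrite -mulrBr normrM ger0_norm ?sqr_ge0// ler_wpM2l ?sqr_ge0//.
    exact: varR.
  have xG : `|l ^+ 2 * S + l * B - s n * (a ^+ 2 * t ^+ 2 / 2)| <=
      l ^+ 2 * N + `|l| * N1.
    by rewrite addrAC (le_trans (ler_normD _ _))// lerD.
  have {}err : `|l ^+ 2 * S + l * B - s n * (a ^+ 2 * t ^+ 2 / 2)| +
      K0 * (n%:R * `|l| ^+ 3 + `|l|) + 3 <= s n * e.
    by apply: le_trans err; rewrite lerD2r [leRHS]addrAC lerD2r.
  apply: (expR_sandwich (x := l ^+ 2 * S + l * B) (y := s n * (a ^+ 2 * t ^+ 2 / 2))
    (z := K0 * (n%:R * `|l| ^+ 3 + `|l|))).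
  - by rewrite [leRHS](_ : _ = s n * e)//; ring.
  - by rewrite [leRHS](_ : _ = s n * e)//; ring.
  - move: mg1 mg2; move: (K0 * _) => z mg1 mg2.
    have Ex w : expR (l ^+ 2 * S + l * B + w) = expR (l * B) * expR (l ^+ 2 * S + w).
      by rewrite -expRD addrCA addrA.
    rewrite !Ex -!(mulrA (expR (l * B))).
    by apply/andP; split; rewrite ler_wpM2l ?expR_ge0.
split => Gamma.
- exact: (gaussian_ldp_open bZ a0 s_infty mgf_lim).
- exact: (gaussian_ldp_closed bZ a0 s_infty mgf_lim).
Unshelve. all: end_near. Qed.
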